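(* Assume $n\geq 1$, $1\leq p<+\infty$ and $-n<a<+\infty$. If $u\in C(\overline{\mathbb{R}^{n}_{+}})$ is a nonnegative solution of $$u(x)=\int_{\mathbb{R}^{n}_{+}}G^{+}(x,y)|y|^{a}u^{p}(y)\,dy,$$ then $u\equiv 0$.
   Context: $n$ is an integer (not assumed even). $\mathbb{R}^{n}_{+}=\{x=(x_{1},\dots,x_{n})\in\mathbb{R}^{n}: x_{n}>0\}$. For $x\in\mathbb{R}^{n}$, $\bar{x}:=(x_{1},\dots,x_{n-1},-x_{n})$. The kernel is $$G^{+}(x,y):=C_{n}\left(\ln\frac{1}{|x-y|}-\ln\frac{1}{|\bar{x}-y|}\right),$$ where $C_{n}>0$ is the normalization constant depending only on $n$ such that $C_{n}\ln\frac{1}{|x|}$ is a fundamental solution of $(-\Delta)^{\frac n2}$ on $\mathbb{R}^{n}$. A solution of the integral equation is a function for which the integral is finite and the identity holds for every $x\in\mathbb{R}^{n}_{+}$. *)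

(* Defs.v *)
From HB Require Import structures.
From mathcomp Require Import all_boot all_order all_algebra.
From mathcomp Require Import all_classical all_reals all_analysis.

Set Implicit Arguments.
Unset Strict Implicit.
Unset Printing Implicit Defensive.

Import Order.TTheory GRing.Theory Num.Theory.
Import numFieldNormedType.Exports.

Local Open Scope classical_set_scope.
Local Open Scope ring_scope.

Section rV_measurable.
Context {R : realType}.
Variable n : nat.

Let coords : 'I_n -> 'rV[R]_n -> measurableTypeR R := fun i x => x 0 i.

Let rV_set0 : g_sigma_preimage coords set0.
Proof. exact: sigma_algebra0. Qed.

Let rV_setC A : g_sigma_preimage coords A -> g_sigma_preimage coords (~` A).
Proof. exact: sigma_algebraC. Qed.

Let rV_bigcup (F : (set 'rV[R]_n)^nat) :
  (forall i, g_sigma_preimage coords (F i)) ->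
  g_sigma_preimage coords (\bigcup_i F i).
Proof. exact: sigma_algebra_bigcup. Qed.

Definition rV_display : measure_display.
Proof. exact: (measure_tuple_display default_measure_display). Qed.

HB.instance Definition _ := @isMeasurable.Build rV_display
  'rV[R]_n (g_sigma_preimage coords) rV_set0 rV_setC rV_bigcup.

Lemma measurable_coord (i : 'I_n) :
  measurable_fun [set: 'rV[R]_n] (fun x : 'rV[R]_n => x 0 i : measurableTypeR R).
Proof.
move=> _ Y mY; rewrite setTI; apply: sub_sigma_algebra => /=.
rewrite -bigcup_seq/=; exists i => /=; first by rewrite mem_index_enum.
by exists Y => //; rewrite setTI.
Qed.

Lemma measurable_fun_rVP d (T : measurableType d) (f : T -> 'rV[R]_n) :
  (forall i, measurable_fun [set: T] (fun x => f x 0 i : measurableTypeR R)) ->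
  measurable_fun [set: T] f.
Proof.
move=> mf.
have sub : g_sigma_preimage (fun i => coords i \o f) `<=` measurable.
  apply: smallest_sub; first exact: sigma_algebra_measurable.
  rewrite -bigcup_seq; apply: bigcup_sub => i _ A [B mB <-].
  exact: mf.
move=> _ A mA; apply: sub; rewrite g_sigma_preimage_comp.
by exists A.
Qed.

End rV_measurable.

Section lebesgue_rV.
Context {R : realType}.

Definition rV_cons n (p : measurableTypeR R * 'rV[R]_n) : 'rV[R]_n.+1 :=
  \row_i (if unlift ord0 i is Some j then p.2 0 j else p.1).

Definition rV_uncons n (x : 'rV[R]_n.+1) : measurableTypeR R * 'rV[R]_n :=
  (x 0 ord0, \row_i x 0 (lift ord0 i)).

Lemma rV_consE n (p : measurableTypeR R * 'rV[R]_n) i :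
  rV_cons p 0 i = if unlift ord0 i is Some j then p.2 0 j else p.1.
Proof. by rewrite mxE. Qed.

Lemma measurable_rV_cons n : measurable_fun setT (@rV_cons n).
Proof.
apply: measurable_fun_rVP => i.
have [j|] := unliftP ord0 i => ->.
  under eq_fun do rewrite rV_consE liftK.
  exact: measurableT_comp (measurable_coord j) measurable_snd.
under eq_fun do rewrite rV_consE unlift_none.
exact: measurable_fst.
Qed.

Lemma measurable_rV_uncons n : measurable_fun setT (@rV_uncons n).
Proof.
apply/measurable_fun_pairP; split => /=; first exact: measurable_coord.
apply: measurable_fun_rVP => i /=.
under eq_fun do rewrite mxE.
exact: measurable_coord.
Qed.

Lemma rV_consK n : cancel (@rV_cons n) (@rV_uncons n).
Proof.
move=> [a x]; rewrite /rV_uncons; congr pair.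
  by rewrite rV_consE unlift_none.
by apply/rowP => i; rewrite mxE rV_consE liftK.
Qed.

Definition lebesgue_cons n
    (m : {sigma_finite_measure set 'rV[R]_n -> \bar R}) :=
  pushforward (@lebesgue_measure R \x m)%E (@rV_cons n).

Section lebesgue_cons.
Variables (n : nat) (m : {sigma_finite_measure set 'rV[R]_n -> \bar R}).

Let cons0 : lebesgue_cons m set0 = 0%E.
Proof. by rewrite /lebesgue_cons /pushforward preimage_set0 measure0. Qed.

Let cons_ge0 A : (0 <= lebesgue_cons m A)%E.
Proof. by rewrite /lebesgue_cons /pushforward; exact: measure_ge0. Qed.

Let cons_sigma_additive : semi_sigma_additive (lebesgue_cons m).
Proof.
move=> F mF tF mUF; rewrite /lebesgue_cons /pushforward preimage_bigcup.
have mp A : measurable A -> measurable (@rV_cons n @^-1` A).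
  by move=> mA; rewrite -[X in measurable X]setTI; exact: measurable_rV_cons.
apply: measure_semi_sigma_additive => [i||]; first exact: mp.
- apply/trivIsetP => /= i j _ _ ij; rewrite -preimage_setI.
  by move/trivIsetP : tF => /(_ _ _ _ _ ij) ->//; rewrite preimage_set0.
- by rewrite -preimage_bigcup; exact: mp.
Qed.

HB.instance Definition _ := isMeasure.Build _ _ _
  (lebesgue_cons m) cons0 cons_ge0 cons_sigma_additive.

Let cons_sigma_finite : sigma_finite setT (lebesgue_cons m).
Proof.
have /sigma_finiteP[F [FT ndF Foo]] := sigma_finiteT (@lebesgue_measure R).
have /sigma_finiteP[G [GT ndG Goo]] := sigma_finiteT m.
exists (fun i => @rV_uncons n @^-1` (F i `*` G i)).
  rewrite -preimage_bigcup -[LHS](preimage_setT (@rV_uncons n)).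
  congr (_ @^-1` _); rewrite -setXTT FT GT predeqE => -[x y]; split.
    move=> [/= [i _ Fix] [k _ Gky]]; exists (maxn i k) => //; split.
    - by move: x Fix; exact/subsetPset/ndF/leq_maxl.
    - by move: y Gky; exact/subsetPset/ndG/leq_maxr.
  by move=> [i _ []/= ? ?]; split; exists i.
move=> k; have [mF Fk] := Foo k; have [mG Gk] := Goo k; split.
  rewrite -[X in measurable X]setTI; apply: measurable_rV_uncons => //.
  exact: measurableX.
rewrite /lebesgue_cons /pushforward -comp_preimage.
rewrite (_ : _ \o _ = id); last by apply/funext => p; exact: rV_consK.
by rewrite preimage_id product_measure1E// lte_mul_pinfty// ge0_fin_numE.
Qed.

HB.instance Definition _ :=
  Measure_isSigmaFinite.Build _ _ _ (lebesgue_cons m) cons_sigma_finite.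

End lebesgue_cons.

(* The library has Lebesgue measure on R only; on R^(n+1) it is the image of
   the product of the measures on R and R^n, on R^0 it is a unit mass. *)
Fixpoint lebesgue_rV n : {sigma_finite_measure set 'rV[R]_n -> \bar R} :=
  if n is k.+1 then lebesgue_cons (lebesgue_rV k) else \d_(0 : 'rV[R]_0).

End lebesgue_rV.

(* The norm of 'rV[R]_n in the library is the sup norm (same topology). *)
Definition dot (R : realType) n (x y : 'rV[R]_n) : R := \sum_i x 0 i * y 0 i.

Definition enorm (R : realType) n (x : 'rV[R]_n) : R := Num.sqrt (dot x x).

Section fundamental_solution.
Context {R : realType}.
Variable n : nat.
Implicit Types (phi E : 'rV[R]_n -> R) (x xi : 'rV[R]_n).
Let mu := @lebesgue_rV R n.

Fixpoint Ck (k : nat) phi : Prop :=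
  continuous phi /\
  if k is j.+1 then
    forall i : 'I_n, (forall x, derivable phi x (delta_mx 0 i)) /\
                     Ck j (fun x => 'D_(delta_mx 0 i) phi x)
  else True.

Definition test_function phi : Prop :=
  (forall k, Ck k phi) /\ compact (closure [set x | phi x != 0]).

Definition fourier_cos phi xi : R := \int[mu]_(y in setT) (phi y * cos (dot y xi)).

Definition fourier_sin phi xi : R := \int[mu]_(y in setT) (phi y * sin (dot y xi)).

(* (-Delta)^s phi is the inverse Fourier transform of |xi|^(2s) phi^(xi), where
   phi^(xi) = \int phi(y) exp(-i y.xi) dy = fourier_cos - i fourier_sin.  For
   real phi the imaginary part of the inversion integrand
   exp(i x.xi) |xi|^(2s) phi^(xi) is odd in xi; its real part is given below. *)
Definition fractional_laplacian (s : R) phi x : R :=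
  ((2 * pi) ^+ n)^-1 *
  \int[mu]_(xi in setT) (enorm xi `^ (2 * s) *
    (cos (dot x xi) * fourier_cos phi xi + sin (dot x xi) * fourier_sin phi xi)).

(* (-Delta)^s E = delta_0 in the sense of distributions. *)
Definition fundamental_solution (s : R) E : Prop :=
  forall phi, test_function phi ->
    mu.-integrable setT (EFin \o (fun x => E x * fractional_laplacian s phi x)) /\
    \int[mu]_(x in setT) (E x * fractional_laplacian s phi x) = phi 0.

End fundamental_solution.

(* The dimension (>= 1) is n.+1, and the last coordinate is ord_max. *)
Section half_space.
Context {R : realType}.
Variable n : nat.
Implicit Types x y : 'rV[R]_n.+1.

Definition half_space : set 'rV[R]_n.+1 := [set x | 0 < x 0 ord_max].

Definition reflection x : 'rV[R]_n.+1 :=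
  \row_i (if i == ord_max then - x 0 i else x 0 i).

(* c is C_n: positive, with c ln(1/|x|) a fundamental solution of
   (-Delta)^(dim/2). *)
Definition normalization_constant (c : R) : Prop :=
  0 < c /\
  fundamental_solution (n.+1%:R / 2)
    (fun x : 'rV[R]_n.+1 => c * ln (1 / enorm x)).

(* At y = x, ln (1 / 0) = 0 by convention; this concerns a null set of y. *)
Definition green (c : R) x y : R :=
  c * (ln (1 / enorm (x - y)) - ln (1 / enorm (reflection x - y))).

Definition integral_solution (c p a : R) (u : 'rV[R]_n.+1 -> R) : Prop :=
  forall x, half_space x ->
    let f y := green c x y * enorm y `^ a * u y `^ p in
    (@lebesgue_rV R n.+1).-integrable half_space (EFin \o f) /\
    u x = \int[@lebesgue_rV R n.+1]_(y in half_space) f y.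

End half_space.

(* Main.v *)
(* On the half space the kernel is (C/2) ln (1 + 4 x_n y_n / |x - y|^2), which
   is invariant under the inversions x |-> l^2 x / |x|^2 with l > 0.  Folding
   the integral over |y| > l back into the ball |y| < l compares u with its
   inverted copy.  Since a > -n, the weight favours the copy, and a positive
   part of u(x) - u(l^2 x / |x|^2) would have to be supported on a set which is
   not too small: the kernel times |y|^a is uniformly integrable, and u is
   bounded near 0.  Hence u(x) <= u(l^2 x / |x|^2) for small l, and the
   property propagates to all l > 0; so u is nondecreasing along rays.
   If u does not vanish, it is then bounded below by some m > 0 on the part of
   height at least 1 of a cone around the x_n-axis.  By homogeneity of the
   integral, a lower bound m on the part of height at least t improves to
   c t^(n + a) m^p, hence to 2 m for t large (p >= 1, n + a > 0);
   iterating gives a contradiction. *)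

(* The order of the operator is half the dimension, so the inverted copy of [u] carries no conformal
   factor. The only factor left after folding is (l^2/|y|^2)^(dim + a), from the Jacobian and the
   weight; it exceeds 1 inside the ball whatever the power [p], so no critical exponent appears.
   Nothing is known about the growth of [u] at infinity. This is why the comparison is made inside
   balls, where continuity up to the boundary bounds [u]. In place of a maximum principle there is a
   smallness principle in measure: a threshold delta, common to all bounded radii, such that if the
   set where the comparison fails has measure at most delta, then any bound S on the excess improves
   to S/2, and the excess vanishes. It is used twice. For small l the whole ball is below the
   threshold. Past a critical radius l0 the failure sets would keep measure above delta, yet they
   accumulate only on the sphere of radius l0, which is null. The change of variables for the
   inversion is obtained without derivatives, from dilations of the space and reflections of the
   line. *)
Require Import Defs.
From mathcomp Require Import all_boot all_order all_algebra.
From mathcomp Require Import all_classical all_reals all_analysis.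
From mathcomp Require Import measurable_realfun ring lra.

Set Implicit Arguments.
Unset Strict Implicit.
Unset Printing Implicit Defensive.

Import Order.TTheory GRing.Theory Num.Theory.
Import numFieldNormedType.Exports.

Local Open Scope classical_set_scope.
Local Open Scope ring_scope.

(** * Lebesgue measure on R^n *)

Section lebesgue_line.
Context {R : realType}.
Let mu := @lebesgue_measure R.
Implicit Type F : R -> \bar R.

Lemma measurable_affine (a b : R) :
  measurable_fun setT (fun s : measurableTypeR R => a * s + b : measurableTypeR R).
Proof. by apply: measurable_funD => //; apply: measurable_funM. Qed.

(** Lebesgue measure is determined by its values on half-open intervals, so that it equals [k] times
    its own image under [phi] has to be checked there only. Dilations and reflections of the line
    are the two instances. *)
Lemma ge0_integral_lebesgue_image (phi : measurableTypeR R -> measurableTypeR R)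
    (k : R) F :
  measurable_fun setT phi -> 0 <= k ->
  (forall a b : R, mu `]a, b]%classic = k%:E * mu (phi @^-1` `]a, b]%classic))%E ->
  measurable_fun [set: measurableTypeR R] F -> (forall s, 0 <= F s)%E ->
  (\int[mu]_s F s = k%:E * \int[mu]_s F (phi s))%E.
Proof.
move=> mphi k0 H mF F0.
pose nu' := mscale (NngNum k0) (pushforward mu phi).
pose nu := nu' mphi.
have E : forall A, measurable A -> mu A = nu A.
  by apply: lebesgue_measure_unique => _ [[a b] /= _ <-]; exact: H.
rewrite [LHS](eq_measure_integral nu) => [|A mA _]; last exact: E.
by rewrite ge0_integral_mscale//= (ge0_integral_pushforward mphi).
Qed.

Lemma ge0_integral_scale1 (t : R) F : 0 < t ->
  measurable_fun [set: measurableTypeR R] F -> (forall s, 0 <= F s)%E ->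
  (\int[mu]_s F s = t%:E * \int[mu]_s F (t * s)%R)%E.
Proof.
move=> t0 mF F0.
apply: (ge0_integral_lebesgue_image (phi := fun s => t * s)) => //.
- by have := measurable_affine t 0; under eq_fun do rewrite addr0.
- exact: ltW.
move=> a b.
have -> : (fun s => t * s) @^-1` `]a, b]%classic = `]a / t, b / t]%classic.
  by apply/seteqP; split => s /=; rewrite !in_itv /=;
    rewrite ltr_pdivrMr// ler_pdivlMr// mulrC.
rewrite /mu !lebesgue_measure_itv /= !lte_fin ltr_pM2r ?invr_gt0//.
case: ifPn => _; last by rewrite mule0.
by rewrite -!EFinB -EFinM; congr EFin; field; rewrite gt_eqF.
Qed.

Lemma ge0_integral_reflect (c : R) F :
  measurable_fun [set: measurableTypeR R] F -> (forall s, 0 <= F s)%E ->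
  (\int[mu]_s F s = \int[mu]_s F (c - s)%R)%E.
Proof.
move=> mF F0; rewrite -[RHS]mul1e.
apply: (ge0_integral_lebesgue_image (phi := fun s => c - s)) => //.
  by have := measurable_affine (-1) c; under eq_fun do rewrite mulN1r addrC.
move=> a b; rewrite mul1e.
have -> : (fun s => c - s) @^-1` `]a, b]%classic = `[c - b, c - a[%classic.
  by apply/seteqP; split => s /=; rewrite !in_itv /= => /andP[? ?]; apply/andP; split; lra.
rewrite /mu !lebesgue_measure_itv /= !lte_fin.
have -> : (c - b < c - a) = (a < b) by rewrite ltrD2l ltrN2.
by case: ifPn => // _; rewrite -!EFinB; congr EFin; ring.
Qed.

End lebesgue_line.

Section lebesgue_space.
Context {R : realType}.
Implicit Type n : nat.

Lemma ge0_integral_rVS n (F : 'rV[R]_n.+1 -> \bar R) : measurable_fun setT F ->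
  (forall x, 0 <= F x)%E ->
  (\int[lebesgue_rV n.+1]_x F x =
   \int[@lebesgue_measure R]_s \int[lebesgue_rV n]_x F (rV_cons (s, x)))%E.
Proof.
move=> mF F0.
have mc := @measurable_rV_cons R n.
rewrite -[LHS]/(\int[pushforward (@lebesgue_measure R \x lebesgue_rV n)%E
  (@rV_cons R n)]_x _)%E.
rewrite (ge0_integral_pushforward mc)//.
by rewrite fubini_tonelli1//=; exact: measurableT_comp mF mc.
Qed.

Lemma scale_rV_cons n (t s : R) (x : 'rV[R]_n) :
  t *: rV_cons (s : measurableTypeR R, x) = rV_cons (t * s : measurableTypeR R, t *: x).
Proof.
by apply/rowP => i; rewrite mxE !rV_consE; case: unliftP => //= j _; rewrite mxE.
Qed.

Lemma measurable_scale_rV d (T : measurableType d) n (c : T -> R) (f : T -> 'rV[R]_n) :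
  measurable_fun setT c -> measurable_fun setT f ->
  measurable_fun setT (fun x => c x *: f x).
Proof.
move=> mc mf; apply: measurable_fun_rVP => i; under eq_fun do rewrite mxE.
by apply: measurable_funM => //; exact: measurableT_comp (measurable_coord i) mf.
Qed.

Lemma measurable_rV_cons_r n (s : R) :
  measurable_fun setT (fun x : 'rV[R]_n => rV_cons (s : measurableTypeR R, x)).
Proof.
apply: measurableT_comp; first exact: measurable_rV_cons.
exact: measurable_pair1.
Qed.

(** By Tonelli each coordinate contributes one factor [t]. Both the inversion formula and the
    scaling of balls are derived from this one change of variables. *)
Lemma ge0_integral_scale n (t : R) (F : 'rV[R]_n -> \bar R) : 0 < t ->
  measurable_fun setT F -> (forall x, 0 <= F x)%E ->
  (\int[lebesgue_rV n]_x F x = (t ^+ n)%:E * \int[lebesgue_rV n]_x F (t *: x))%E.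
Proof.
move=> t0; elim: n F => [|n IH] F mF F0.
  have mt : measurable_fun setT (fun x : 'rV[R]_0 => F (t *: x)).
    exact/(measurableT_comp mF)/measurable_scale_rV.
  by rewrite !integral_dirac// !diracE in_setT !mul1e scaler0.
have mt : measurable_fun setT (fun x : 'rV[R]_n.+1 => F (t *: x)).
  exact/(measurableT_comp mF)/measurable_scale_rV.
rewrite !ge0_integral_rVS//.
under eq_integral => s _.
  rewrite IH//; last by apply: (measurableT_comp mF); exact: measurable_rV_cons_r.
  over.
have mG : measurable_fun setT
    (fun p : measurableTypeR R * 'rV[R]_n => F (rV_cons (p.1, t *: p.2))).
  apply: (measurableT_comp mF); apply: measurableT_comp; first exact: measurable_rV_cons.
  apply/measurable_fun_pairP; split; first exact: measurable_fst.
  by apply: (@measurable_scale_rV _ _ n (cst t) snd).  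
rewrite ge0_integralZl//=; last 3 first.
- exact: (measurable_fun_fubini_tonelli_F _ mG).
- by move=> s _; exact: integral_ge0.
- by rewrite lee_fin exprn_ge0// ltW.
rewrite (ge0_integral_scale1 t0); last 2 first.
- exact: (measurable_fun_fubini_tonelli_F _ mG).
- by move=> s; exact: integral_ge0.
rewrite muleA -EFinM -exprSr; congr (_ * _)%E.
by apply: eq_integral => s _; apply: eq_integral => x _; rewrite scale_rV_cons.
Qed.

Definition box n (c : 'I_n -> R * R) : set 'rV[R]_n :=
  [set x | forall i, (c i).1 <= x 0 i <= (c i).2].

Lemma measurable_box n (c : 'I_n -> R * R) : measurable (box c).
Proof.
have -> : box c = \bigcap_(i in [set: 'I_n])
    ((fun x : 'rV[R]_n => x 0 i) @^-1` `[(c i).1, (c i).2]%classic).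
  apply/seteqP; split => [x H i _|x H i] /=; first by rewrite in_itv; exact: H.
  by have := H i Logic.I; rewrite /= in_itv.
apply: fin_bigcap_measurable => // i _.
by rewrite -[X in measurable X]setTI; exact: measurable_coord.
Qed.

Lemma lebesgue_rV_box n (c : 'I_n -> R * R) : (forall i, (c i).1 <= (c i).2) ->
  lebesgue_rV n (box c) = (\prod_i ((c i).2 - (c i).1))%:E.
Proof.
elim: n c => [|n IH] c hc.
  by rewrite big_ord0 /= diracE mem_set// => -[].
rewrite -[LHS]/((@lebesgue_measure R \x lebesgue_rV n)%E (@rV_cons R n @^-1` box c)).
have -> : @rV_cons R n @^-1` box c =
    `[(c ord0).1, (c ord0).2]%classic `*` box (fun i => c (lift ord0 i)).
  apply/seteqP; split => [[s x]/= H|[s x]/= [/= H1 H2] i].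
    split => /=; first by have := H ord0; rewrite rV_consE unlift_none in_itv.
    by move=> i; have := H (lift ord0 i); rewrite rV_consE liftK.
  by rewrite rV_consE; case: unliftP => [j ->|->] //=.
rewrite product_measure1E//; last exact: measurable_box.
rewrite IH// big_ord_recl EFinM; congr (_ * _)%E.
rewrite -[LHS]/(lebesgue_measure _) lebesgue_measure_itv /= lte_fin.
by case: ltgtP (hc ord0) => //= ->; rewrite subrr.
Qed.

End lebesgue_space.

(** * Inversion in a sphere *)

Section euclidean.
Context {R : realType}.
Variable n : nat.
Implicit Types x y z : 'rV[R]_n.

Lemma dotC x y : dot x y = dot y x.
Proof. by apply: eq_bigr => i _; rewrite mulrC. Qed.

Lemma dotDl x y z : dot (x + y) z = dot x z + dot y z.
Proof. by rewrite /dot -big_split; apply: eq_bigr => i _; rewrite mxE mulrDl. Qed.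

Lemma dotZl (t : R) x y : dot (t *: x) y = t * dot x y.
Proof. by rewrite /dot mulr_sumr; apply: eq_bigr => i _; rewrite mxE mulrA. Qed.

Lemma dotDr x y z : dot x (y + z) = dot x y + dot x z.
Proof. by rewrite dotC dotDl !(dotC x). Qed.

Lemma dotZr (t : R) x y : dot x (t *: y) = t * dot x y.
Proof. by rewrite dotC dotZl dotC. Qed.

Lemma dotNl x y : dot (- x) y = - dot x y.
Proof. by rewrite -scaleN1r dotZl mulN1r. Qed.

Lemma dotNr x y : dot x (- y) = - dot x y.
Proof. by rewrite dotC dotNl dotC. Qed.

Definition sqn x : R := dot x x.

Lemma sqn_ge0 x : 0 <= sqn x.
Proof. by apply: sumr_ge0 => i _; rewrite -expr2 sqr_ge0. Qed.

Lemma sqr_coord_le_sqn x i : x 0 i ^+ 2 <= sqn x.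
Proof.
rewrite /sqn /dot (bigD1 i)//= -expr2 lerDl.
by apply: sumr_ge0 => j _; rewrite -expr2 sqr_ge0.
Qed.

Lemma sqn_eq0 x : (sqn x == 0) = (x == 0).
Proof.
apply/eqP/eqP => [H|->]; last by rewrite /sqn /dot big1// => i _; rewrite mxE mul0r.
apply/rowP => i; rewrite mxE; apply/eqP; rewrite -sqrf_eq0 eq_le sqr_ge0 andbT -H.
exact: sqr_coord_le_sqn.
Qed.

Lemma sqn_gt0 x : (0 < sqn x) = (x != 0).
Proof. by rewrite lt_def sqn_ge0 andbT sqn_eq0. Qed.

Lemma sqnZ (t : R) x : sqn (t *: x) = t ^+ 2 * sqn x.
Proof. by rewrite /sqn dotZl dotZr mulrA expr2. Qed.

Lemma sqnB x y : sqn (x - y) = sqn x + sqn y - 2 * dot x y.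
Proof. by rewrite /sqn dotDl !dotDr !dotNl !dotNr (dotC y x); ring. Qed.

Definition sphinv (l : R) x := (l ^+ 2 / sqn x) *: x.

Lemma sqn_sphinv l x : x != 0 -> sqn (sphinv l x) = l ^+ 4 / sqn x.
Proof. by move=> x0; rewrite sqnZ; field; rewrite sqn_eq0. Qed.

Lemma sphinvK l x : l != 0 -> x != 0 -> sphinv l (sphinv l x) = x.
Proof.
move=> l0 x0; rewrite {1}/sphinv sqn_sphinv// scalerA -[RHS]scale1r; congr (_ *: _).
by field; rewrite ?l0 ?sqn_eq0 ?x0.
Qed.

Lemma sphinv_id l x : l != 0 -> sqn x = l ^+ 2 -> sphinv l x = x.
Proof. by move=> l0 E; rewrite /sphinv E divff ?scale1r// expf_neq0. Qed.

Lemma sphinv0 l : sphinv l 0 = 0.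
Proof. by rewrite /sphinv scaler0. Qed.

End euclidean.

Section measurability.
Context d (T : measurableType d) (R : realType).
Implicit Type D : set T.

Lemma measurable_fun_dot n D (f g : T -> 'rV[R]_n) : measurable_fun D f -> measurable_fun D g ->
  measurable_fun D (fun x => dot (f x) (g x)).
Proof.
move=> mf mg; rewrite /dot; apply: measurable_sum => i.
by apply: measurable_funM; apply: (measurableT_comp (measurable_coord i)).
Qed.

Lemma measurable_fun_inv D (f : T -> R) :
  measurable_fun D f -> measurable_fun D (fun x => (f x)^-1).
Proof.
move=> mf.
(* The square keeps the base nonnegative, where the real power is the true reciprocal; at a zero of
   [f] both sides are 0. *)
have -> : (fun x => (f x)^-1) = (fun x => f x * (f x ^+ 2) `^ (-1)).
  apply/funext => x; rewrite powR_inv1 ?sqr_ge0//.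
  have [->|fx] := eqVneq (f x) 0; first by rewrite invr0 mul0r.
  by field.
apply: measurable_funM => //.
exact: (measurableT_comp (measurable_powR (-1)) (measurable_funX 2 mf)).
Qed.

Lemma measurable_fun_natr D (b : T -> bool) : measurable_fun D b ->
  measurable_fun D (fun x => (b x)%:R : R).
Proof. exact: (@measurableT_comp _ _ _ _ _ _ (fun c : bool => c%:R : R)). Qed.

End measurability.

Section inversion.
Context {R : realType}.
Variable n : nat.
Let mu := @lebesgue_rV R n.
Let leb := @lebesgue_measure R.
Implicit Types (x y z : 'rV[R]_n) (F : 'rV[R]_n -> \bar R).

Lemma measurable_fun_sqn d (T : measurableType d) (D : set T) (f : T -> 'rV[R]_n) :
  measurable_fun D f -> measurable_fun D (fun t => sqn (f t)).
Proof. by move=> mf; exact: measurable_fun_dot. Qed.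

Lemma measurable_sphinv l : measurable_fun setT (@sphinv R n l).
Proof.
apply: measurable_scale_rV => //; apply: measurable_funM => //.
apply: measurable_fun_inv.
exact: measurable_fun_sqn.
Qed.

(* The s for which exp(s) y lies in the shell form an interval of length 1, so
   integrating over all dilations turns an integral over R^n into one over the
   shell and s, where the inversion only acts as a reflection s |-> c - s. *)
Let shell z : R := (1 <= sqn z < expR 2)%R%:R.

Let shell_ge0 z : 0 <= shell z. Proof. by rewrite ler0n. Qed.

Let measurable_shell d (T : measurableType d) (f : T -> 'rV[R]_n) :
  measurable_fun setT f -> measurable_fun setT (fun t => shell (f t)).
Proof.
move=> mf; apply: measurable_fun_natr; apply: measurable_and.
  by apply: measurable_fun_ler => //; exact: measurable_fun_sqn.
by apply: measurable_fun_ltr => //; exact: measurable_fun_sqn.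
Qed.

Let integral_shell y : y != 0 -> (\int[leb]_s (shell (expR s *: y))%:E = 1)%E.
Proof.
move=> y0; have q0 : 0 < sqn y by rewrite sqn_gt0.
pose c := - ln (sqn y) / 2.
under eq_integral => s _.
  have -> : shell (expR s *: y) = \1_(`[c, c + 1[%classic) s.
    rewrite /shell indicE mem_setE in_itv /= sqnZ; congr (_%:R).
    rewrite -{1 2}(lnK q0) -expRM_natl -expRD -[X in X <= _]expR0 ler_expR ltr_expR /c.
    by congr (nat_of_bool (_ && _)); apply/idP/idP; lra.
  over.
rewrite integral_indic// setIT -[LHS]/(lebesgue_measure _) lebesgue_measure_itv /=.
rewrite lte_fin ltrDl ltr01.
by rewrite -EFinB; congr EFin; ring.
Qed.

Let radial_integral F : measurable_fun setT F -> (forall x, 0 <= F x)%E -> F 0 = 0%E ->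
  (\int[mu]_y F y = \int[mu]_z \int[leb]_s
    (F (expR (- s) *: z) * (expR (- s) ^+ n)%:E * (shell z)%:E))%E.
Proof.
move=> mF F0 F00.
have mexp : measurable_fun setT (fun p : 'rV[R]_n * measurableTypeR R => expR p.2).
  exact: measurableT_comp.
have mexpN : measurable_fun setT (fun p : 'rV[R]_n * measurableTypeR R => expR (- p.2)).
  by apply: measurableT_comp => //; exact: measurableT_comp.
have m1 : measurable_fun setT (fun p : 'rV[R]_n * measurableTypeR R =>
    F p.1 * (shell (expR p.2 *: p.1))%:E)%E.
  apply: emeasurable_funM; first exact: measurableT_comp.
  by apply/measurable_EFinP/measurable_shell/measurable_scale_rV.
have m2 : measurable_fun setT (fun p : 'rV[R]_n * measurableTypeR R =>
    F (expR (- p.2) *: p.1) * (expR (- p.2) ^+ n)%:E * (shell p.1)%:E)%E.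
  apply: emeasurable_funM; last by apply/measurable_EFinP/measurable_shell.
  apply: emeasurable_funM; last by apply/measurable_EFinP/measurable_funX.
  by apply: measurableT_comp mF _; exact: measurable_scale_rV.
(* Insert 1 as the integral of [shell (expR s *: y)] over s, exchange the integrals, then substitute
   y = exp(-s) z for fixed s. *)
transitivity (\int[mu]_y \int[leb]_s (F y * (shell (expR s *: y))%:E))%E.
  apply: eq_integral => y _.
  have ms : measurable_fun setT (fun s : measurableTypeR R => shell (expR s *: y)).
    by apply: measurable_shell; exact: measurable_scale_rV.
  rewrite ge0_integralZl//; last 2 first.
  - exact/measurable_EFinP.
  - by move=> s _; rewrite lee_fin.
  by have [->|y0] := eqVneq y 0; [rewrite F00 mul0e|rewrite integral_shell// mule1].
rewrite (fubini_tonelli _ m1)/=; last by move=> p; rewrite mule_ge0// lee_fin.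
rewrite [RHS](fubini_tonelli _ m2)/=; last first.
  by move=> p; rewrite !mule_ge0// lee_fin// exprn_ge0// expR_ge0.
apply: eq_integral => s _.
have t0 := expR_gt0 (- s).
rewrite (ge0_integral_scale t0); last 2 first.
- exact: (measurableT_comp m1 (measurable_pair2 _)).
- by move=> y; rewrite mule_ge0// lee_fin.
rewrite -ge0_integralZl//; last 2 first.
- apply: measurableT_comp (measurableT_comp m1 (measurable_pair2 s)) _.
  exact: measurable_scale_rV.
- by move=> y _; rewrite mule_ge0// lee_fin.
apply: eq_integral => z _.
rewrite scalerA -expRD subrr expR0 scale1r muleA; congr (_ * _)%E.
by rewrite muleC.
Qed.

(** The factor is the Jacobian of the inversion. The condition [F 0 = 0] settles the centre, which
    [sphinv] fixes by convention instead of sending it to infinity. *)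
Lemma ge0_integral_sphinv (l : R) F : 0 < l ->
  measurable_fun setT F -> (forall x, 0 <= F x)%E -> F 0 = 0%E ->
  (\int[mu]_y F y = \int[mu]_y (F (sphinv l y) * ((l ^+ 2 / sqn y) ^+ n)%:E))%E.
Proof.
move=> l0 mF F0 F00.
have mJ : measurable_fun setT (fun y => (l ^+ 2 / sqn y) ^+ n).
  apply: measurable_funX; apply: measurable_funM => //.
  apply: measurable_fun_inv.
  exact: measurable_fun_sqn.
have J0 y : 0 <= (l ^+ 2 / sqn y) ^+ n.
  by rewrite exprn_ge0// divr_ge0 ?sqn_ge0 ?sqr_ge0.
rewrite radial_integral// [RHS]radial_integral; last 3 first.
- apply: emeasurable_funM; last exact/measurable_EFinP.
  exact: measurableT_comp mF (@measurable_sphinv l).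
- by move=> y; rewrite mule_ge0// lee_fin.
- by rewrite sphinv0 F00 mul0e.
apply: eq_integral => z _.
have [z0|/negPf z0] := boolP (1 <= sqn z < expR 2); last first.
  by rewrite /shell z0; under eq_integral do rewrite mule0;
    under [RHS]eq_integral do rewrite mule0.
rewrite /shell z0.
have q0 : 0 < sqn z by case/andP: z0 => + _; apply: lt_le_trans.
have mG : measurable_fun setT (fun s : measurableTypeR R =>
    F (expR (- s) *: z) * (expR (- s) ^+ n)%:E * 1%:E)%E.
  have mN : measurable_fun setT (fun s : measurableTypeR R => expR (- s)).
    exact: measurableT_comp.
  apply: emeasurable_funM => //.
  apply: emeasurable_funM; last by apply/measurable_EFinP/measurable_funX.
  by apply: measurableT_comp mF _; exact: measurable_scale_rV.
(* On the ray through z the inversion sends exp(-s) z to exp(-(c - s)) z with c = ln(|z|^2/l^2). *)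
rewrite (ge0_integral_reflect (ln (sqn z / l ^+ 2)) mG); last first.
  by move=> s; rewrite !mule_ge0// lee_fin// exprn_ge0// expR_ge0.
apply: eq_integral => s _; congr (_ * _)%E.
have e0 := expR_gt0 s.
have -> : expR (- (ln (sqn z / l ^+ 2) - s)) = expR s / (sqn z / l ^+ 2).
  by rewrite opprB expRD expRN lnK// posrE divr_gt0// exprn_gt0.
rewrite /sphinv !sqnZ scalerA -muleA -EFinM -exprMn expRN.
have ne : expR s != 0 by rewrite gt_eqF.
have nq : sqn z != 0 by rewrite gt_eqF.
have nl : l != 0 by rewrite gt_eqF.
by congr (F (_ *: _) * (_ ^+ _)%:E)%E; field; rewrite ?ne ?nq ?nl.
Qed.

End inversion.

(** * Singular integrals over small sets *)

Section power.
Context {R : realType}.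
Implicit Types x y z r : R.

Lemma powR_le_neg x y r : 0 < x -> x <= y -> 0 <= r -> y `^ (- r) <= x `^ (- r).
Proof.
move=> x0 xy r0; rewrite !powRN lef_pV2 ?posrE ?powR_gt0//; last exact: lt_le_trans xy.
by rewrite ge0_ler_powR// nnegrE ltW//; exact: lt_le_trans xy.
Qed.

Lemma sqrt_powR x r : 0 <= x -> Num.sqrt x `^ r = x `^ (r / 2).
Proof. by move=> x0; rewrite -powR12_sqrt// -powRrM mulrC. Qed.

Lemma pow2_ge_nat (x : R) : exists k : nat, x <= 2 ^+ k.
Proof.
exists (Num.bound `|x|); apply: (le_trans (ler_norm x)).
apply: (le_trans (ltW (archi_boundP (normr_ge0 x)))).
by rewrite -natrX ler_nat ltnW// ltn_expl.
Qed.

End power.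

Lemma measurable_rVB (R : realType) n (x : 'rV[R]_n) :
  measurable_fun setT (fun y : 'rV[R]_n => x - y).
Proof.
apply: measurable_fun_rVP => i; under eq_fun do rewrite !mxE.
by apply: measurable_funB => //; exact: measurable_coord.
Qed.

Section singular.
Context {R : realType}.
Variable n : nat.
Let mu := @lebesgue_rV R n.
Implicit Types x y : 'rV[R]_n.

Definition cube x (r : R) : set 'rV[R]_n := box (fun i => (x 0 i - r, x 0 i + r)).

Lemma measurable_cube x r : measurable (cube x r). Proof. exact: measurable_box. Qed.

Lemma lebesgue_rV_cube x (r : R) : 0 <= r -> mu (cube x r) = ((2 * r) ^+ n)%:E.
Proof.
move=> r0; rewrite /mu /cube lebesgue_rV_box => [|i /=]; last by lra.
congr EFin; rewrite (eq_bigr (fun=> 2 * r)) => [|i _ /=]; last by ring.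
by rewrite prodr_const card_ord.
Qed.

Lemma cubeP x y (r : R) : cube x r y <-> forall i, `|x 0 i - y 0 i| <= r.
Proof.
split => H i; have := H i; rewrite /= ler_norml => /andP[? ?].
  by apply/andP; split; lra.
by rewrite /=; apply/andP; split; lra.
Qed.

Lemma cube_sqn x y (r : R) : 0 <= r -> sqn (x - y) <= r ^+ 2 -> cube x r y.
Proof.
move=> r0 H; apply/cubeP => i; rewrite -ler_sqr ?nnegrE// real_normK ?num_real//.
by apply: le_trans H; have := sqr_coord_le_sqn (x - y) i; rewrite !mxE.
Qed.

Variable b : R.
Hypothesis b0 : 0 < b.
Hypothesis bn : 2 * b < n%:R.

(** The k-th dyadic cube contributes (r 2^-(k+1))^(-2b) (2 r 2^-k)^n = [K] r^[g] [th]^k. The ratio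
    [th] of this geometric series is below 1 because 2b < n. *)
Let g : R := n%:R - 2 * b.
Let th : R := 2 `^ (- g).
Let K : R := 2 `^ (2 * b) * 2 ^+ n.
Let th0 : 0 < th. Proof. by rewrite powR_gt0. Qed.
Let th1 : th < 1.
Proof.
rewrite /th powRN invf_lt1 ?powR_gt0//.
have g0 : 0 < g by rewrite /g subr_gt0.
have : (1 : R) `^ g < 2 `^ g by rewrite gt0_ltr_powR ?nnegrE// ltr1n.
by rewrite powR1.
Qed.

(* These dominate |x - y|^(-2b) for |x - y| < r: the k-th one does so on the
   dyadic annulus r 2^-(k+1) <= |x - y| <= r 2^-k. *)
Let term (x : 'rV[R]_n) (r : R) (k : nat) y : R :=
  (r * 2 ^- k.+1) `^ (- (2 * b)) * \1_(cube x (r * 2 ^- k)) y.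

Let integral_term x (r : R) k : 0 < r ->
  (\int[mu]_y (term x r k y)%:E = (K * r `^ g * th ^+ k)%:E)%E.
Proof.
move=> r0; rewrite /term.
have t0 : (0 : R) < 2 ^- k by rewrite invr_gt0 exprn_gt0.
under eq_integral do rewrite EFinM.
rewrite ge0_integralZl//=; last 2 first.
- by apply/measurable_EFinP; apply: measurable_indic; exact: measurable_cube.
- by rewrite lee_fin powR_ge0.
rewrite integral_indic ?setIT//; last exact: measurable_cube.
rewrite [X in (_ * X)%E]lebesgue_rV_cube ?mulr_ge0 ?(ltW r0) ?(ltW t0)// -EFinM; congr EFin.
rewrite exprS invfM mulrCA [2^-1 * _]mulrC.
set t := r * 2 ^- k; have tp : 0 < t by rewrite mulr_gt0.
rewrite exprMn -(powR_mulrn n (ltW tp)) powRM ?invr_ge0 ?(ltW tp)//.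
have -> : (2^-1 : R) `^ (- (2 * b)) = 2 `^ (2 * b).
  by rewrite -powR_inv1// -powRrM mulN1r opprK.
have E : t `^ (- (2 * b)) * t `^ n%:R = r `^ g * th ^+ k.
  rewrite -powRD; last by apply/implyP => _; rewrite gt_eqF.
  rewrite addrC -/g /t powRM ?(ltW r0) ?(ltW t0)//; congr (_ * _).
  by rewrite -powR_invn// -powRrM /th -powR_mulrn ?powR_ge0// -powRrM; congr (_ `^ _); ring.
by rewrite -[RHS]mulrA -E /K; ring.
Qed.

Let term_ge0 x (r : R) k y : 0 <= term x r k y.
Proof. by rewrite mulr_ge0 ?powR_ge0// indicE ler0n. Qed.

Let measurable_term x r k : measurable_fun setT (EFin \o term x r k).
Proof.
apply/measurable_EFinP; apply: measurable_funM => //.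
by apply: measurable_indic; exact: measurable_cube.
Qed.

Let le_term x (r : R) y : 0 < r -> sqn (x - y) < r ^+ 2 ->
  exists k, sqn (x - y) `^ (- b) <= term x r k y.
Proof.
move=> r0 qr; have [q0|q0] := eqVneq (sqn (x - y)) 0.
  (* At the pole the convention 0^(-b) = 0 makes any index suitable. *)
  exists 0; apply: le_trans (term_ge0 _ _ _ _); rewrite q0 powR0// oppr_eq0.
  by rewrite gt_eqF.
have {q0} q0 : 0 < sqn (x - y) by rewrite lt_def q0 sqn_ge0.
set q := sqn _ in qr q0 *.
pose s := Num.sqrt q.
have s0 : 0 < s by rewrite sqrtr_gt0.
have sr : s < r by rewrite -ltr_sqr ?nnegrE ?ltW// sqr_sqrtr// ltW.
have exP : exists k, r * 2 ^- k.+1 <= s.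
  have [k hk] := pow2_ge_nat (r / s).
  exists k; rewrite ler_pdivrMr ?exprn_gt0// mulrC -ler_pdivrMr//.
  by apply: (le_trans hk); rewrite ler_eXn2l// ltr1n.
(* The least k with r 2^-(k+1) <= |x - y|; by minimality also |x - y| <= r 2^-k, the case k = 0
   being |x - y| < r. *)
case: (ex_minnP exP) => k hk hmin; exists k.
have sk : s <= r * 2 ^- k.
  case: k hk hmin => [_ _|k hk hmin]; first by rewrite expr0 invr1 mulr1 ltW.
  by rewrite leNgt; apply/negP => /ltW /hmin; rewrite ltnn.
have kk : 0 < r * 2 ^- k by rewrite mulr_gt0// invr_gt0 exprn_gt0.
rewrite /term indicE mem_set ?mulr1; last first.
  apply: cube_sqn; first exact: ltW.
  have : s ^+ 2 <= (r * 2 ^- k) ^+ 2 by rewrite ler_sqr ?nnegrE ?(ltW s0) ?(ltW kk).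
  by rewrite sqr_sqrtr ?(ltW q0).
have -> : q `^ (- b) = s `^ (- (2 * b)).
  by rewrite /s sqrt_powR ?(ltW q0)//; congr (_ `^ _); field.
apply: powR_le_neg => //; first by rewrite mulr_gt0// invr_gt0 exprn_gt0.
by rewrite mulr_ge0// ltW.
Qed.

Let singular_tail x (r : R) : 0 < r ->
  (\int[mu]_y (((sqn (x - y) < r ^+ 2)%R%:R : R) * sqn (x - y) `^ (- b))%:E
    <= (K * r `^ g / (1 - th))%:E)%E.
Proof.
move=> r0.
apply: (@le_trans _ _ (\int[mu]_y \sum_(k <oo) (term x r k y)%:E)%E).
  apply: ge0_le_integral => //.
  - by move=> y _; rewrite lee_fin mulr_ge0 ?powR_ge0 ?ler0n.
  - apply/measurable_EFinP; apply: measurable_funM.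
      apply: measurable_fun_natr; apply: measurable_fun_ltr => //.
      by apply: measurable_fun_sqn; apply: measurable_rVB.
    apply: (measurableT_comp (measurable_powR (- b))).
    by apply: measurable_fun_sqn; apply: measurable_rVB.
  - by apply: ge0_emeasurable_sum => [k y _ _|k _]; [rewrite lee_fin|exact: measurable_term].
  - move=> y _; case: (ltP (sqn (x - y)) (r ^+ 2)) => [qr|_]; last first.
      by rewrite mul0r; apply: nneseries_ge0 => k _ _; rewrite lee_fin.
    rewrite mul1r; have [k hk] := le_term r0 qr.
    apply: (@le_trans _ _ (\sum_(0 <= i < k.+1) (term x r i y)%:E)%E); last first.
      by apply: nneseries_lim_ge => i _ _; rewrite lee_fin.
    rewrite sumEFin lee_fin; apply: (le_trans hk).
    by rewrite big_nat_recr//= lerDr; apply: sumr_ge0.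
rewrite integral_nneseries//; last 2 first.
- by move=> k; exact: measurable_term.
- by move=> k y _; rewrite lee_fin.
under eq_eseriesr do rewrite integral_term//.
apply: lime_le.
  by apply: is_cvg_nneseries => k _ _; rewrite lee_fin !mulr_ge0 ?powR_ge0 ?exprn_ge0 ?(ltW th0).
apply: nearW => m; rewrite sumEFin lee_fin.
have := @geometric_le_lim _ m (K * r `^ g) th.
apply => //; rewrite ?ger0_norm ?(ltW th0)//.
by rewrite mulr_ge0 ?powR_ge0// mulr_ge0 ?powR_ge0 ?exprn_ge0.
Qed.

(** Uniform integrability, with [delta] independent of the pole [x]: the part within distance r of
    [x] is small by the dyadic series, and farther away the integrand is at most r^(-2b). *)
Lemma singular_integral_small (eta : R) : 0 < eta -> exists2 delta : R, 0 < delta &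
  forall x (A : set 'rV[R]_n), measurable A -> (mu A <= delta%:E)%E ->
    (\int[mu]_(y in A) (sqn (x - y) `^ (- b))%:E <= eta%:E)%E.
Proof.
move=> eta0.
have K0 : 0 < K by rewrite mulr_gt0 ?powR_gt0 ?exprn_gt0.
have g0 : 0 < g by rewrite /g subr_gt0.
(* The radius for which the bound of the near part equals eta/2; [delta] below is then chosen so
   that r^(-2b) [delta] = eta/2. *)
pose r := (eta * (1 - th) / (2 * K)) `^ g^-1.
have r0 : 0 < r by rewrite powR_gt0// divr_gt0 ?mulr_gt0// subr_gt0.
have rg : K * r `^ g / (1 - th) = eta / 2.
  rewrite -powRrM mulVf ?gt_eqF// powRr1; last first.
    by rewrite divr_ge0 ?mulr_ge0 ?subr_ge0 ?ltW.
  by field; rewrite (gt_eqF K0) gt_eqF// subr_gt0.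
have rb0 : 0 < (r ^+ 2) `^ (- b) by rewrite powR_gt0// exprn_gt0.
exists (eta / 2 / (r ^+ 2) `^ (- b)); first by rewrite !divr_gt0.
move=> x A mA hA.
have mw : measurable_fun setT (fun y => sqn (x - y) `^ (- b)).
  apply: (measurableT_comp (measurable_powR (- b))).
  by apply: measurable_fun_sqn; apply: measurable_rVB.
have mt : measurable_fun setT (fun y => (sqn (x - y) < r ^+ 2)%R%:R * sqn (x - y) `^ (- b) : R).
  apply: measurable_funM mw; apply: measurable_fun_natr; apply: measurable_fun_ltr => //.
  by apply: measurable_fun_sqn; apply: measurable_rVB.
have mi : measurable_fun setT (fun y => (r ^+ 2) `^ (- b) * \1_A y : R).
  by apply: measurable_funM => //; exact: measurable_indic.
have t0 y : 0 <= (sqn (x - y) < r ^+ 2)%R%:R * sqn (x - y) `^ (- b).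
  by rewrite mulr_ge0 ?powR_ge0 ?ler0n.
have i0 y : 0 <= (r ^+ 2) `^ (- b) * \1_A y by rewrite mulr_ge0 ?(ltW rb0) ?indicE ?ler0n.
rewrite integral_mkcond.
apply: (@le_trans _ _ (\int[mu]_y (((sqn (x - y) < r ^+ 2)%R%:R * sqn (x - y) `^ (- b))%:E
    + ((r ^+ 2) `^ (- b) * \1_A y)%:E))%E).
  apply: ge0_le_integral => //.
  - by move=> y _; apply: erestrict_ge0 => z _; rewrite lee_fin powR_ge0.
  - apply/(measurable_restrictT _ mA); apply: measurable_funTS; exact/measurable_EFinP.
  - by apply: emeasurable_funD; exact/measurable_EFinP.
  - move=> y _; rewrite /patch; case: ifPn => yA; last first.
      by rewrite -EFinD lee_fin addr_ge0.
    rewrite -EFinD lee_fin indicE yA mulr1.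
    case: (ltP (sqn (x - y)) (r ^+ 2)) => [_|h].
      by rewrite mul1r lerDl ltW.
    by rewrite mul0r add0r powR_le_neg// ?exprn_gt0// ltW.
rewrite ge0_integralD//; last 4 first.
- by move=> y _; rewrite lee_fin.
- exact/measurable_EFinP.
- by move=> y _; rewrite lee_fin.
- exact/measurable_EFinP.
have -> : (eta%:E = (eta / 2)%:E + (eta / 2)%:E)%E by rewrite -EFinD -splitr.
apply: leeD; first by rewrite -rg; exact: singular_tail.
under eq_integral do rewrite EFinM.
rewrite ge0_integralZl//; last 2 first.
- by apply/measurable_EFinP; exact: measurable_indic.
- by rewrite lee_fin ltW.
rewrite integral_indic ?setIT//.
apply: (@le_trans _ _ (((r ^+ 2) `^ (- b))%:E * (eta / 2 / (r ^+ 2) `^ (- b))%:E)%E).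
  by apply: lee_wpmul2l => //; rewrite lee_fin ltW.
by rewrite -EFinM lee_fin mulrC divfK// gt_eqF.
Qed.

End singular.

(** * The Green kernel of the half space *)

Section kernel.
Context {R : realType}.
Variable n : nat.
Implicit Types x y : 'rV[R]_n.+1.

Definition height x : R := x 0 ord_max.

(** In the half space this is 1 / (2 (cosh d - 1)) with d the hyperbolic distance of [x] and [y].
    Inversions centred at 0 are hyperbolic isometries, whence the invariance of the kernel. *)
Definition hratio x y : R := height x * height y / sqn (x - y).

(* Pitfall: gker c x x = 0 by division by zero, so gker c x is not largest at
   the pole; inequalities between kernels need x != y. *)
Definition gker (c : R) x y : R := c / 2 * ln (1 + 4 * hratio x y).

Lemma sqn_reflection x y :
  sqn (reflection x - y) = sqn (x - y) + 4 * (height x * height y).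
Proof.
rewrite /sqn /dot /height (bigD1 ord_max)//= [in RHS](bigD1 ord_max)//= !mxE eqxx.
rewrite (eq_bigr (fun i => (x - y) 0 i * (x - y) 0 i)) => [|i /negPf hi].
  by ring.
by rewrite !mxE hi.
Qed.

Lemma ln_enorm x : x != 0 -> ln (1 / enorm x) = - (ln (sqn x) / 2).
Proof.
move=> x0; have q0 : 0 < sqn x by rewrite sqn_gt0.
rewrite div1r lnV ?posrE ?sqrtr_gt0// /enorm -powR12_sqrt ?sqn_ge0// ln_powR.
by rewrite mulrC.
Qed.

Lemma enorm_powR x (a : R) : enorm x `^ a = sqn x `^ (a / 2).
Proof. by rewrite sqrt_powR// sqn_ge0. Qed.

Lemma half_space_neq0 x : half_space x -> x != 0.
Proof. by apply: contraTneq => ->; rewrite mxE ltxx. Qed.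

Lemma green_gker c x y : half_space x -> half_space y -> x != y ->
  green c x y = gker c x y.
Proof.
move=> hx hy xy; have xy0 : x - y != 0 by rewrite subr_eq0.
have q0 : 0 < sqn (x - y) by rewrite sqn_gt0.
have h0 : 0 < height x * height y by apply: mulr_gt0.
have r0 : 0 < sqn (reflection x - y) by rewrite sqn_reflection; lra.
rewrite /green /gker !ln_enorm -?sqn_gt0//.
have -> : 1 + 4 * hratio x y = sqn (reflection x - y) / sqn (x - y).
  by rewrite sqn_reflection /hratio; field; rewrite gt_eqF.
by rewrite ln_div ?posrE//; ring.
Qed.

Lemma ratio_ge0 x y : 0 <= height x -> 0 <= height y -> 0 <= hratio x y.
Proof. by move=> ? ?; rewrite divr_ge0 ?mulr_ge0 ?sqn_ge0. Qed.

Lemma gker_ge0 c x y : 0 <= c -> 0 <= height x -> 0 <= height y -> 0 <= gker c x y.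
Proof.
move=> c0 hx hy; rewrite mulr_ge0 ?divr_ge0// ln_ge0// lerDl mulr_ge0//.
exact: ratio_ge0.
Qed.

Lemma gker_lt c x y z w : 0 < c -> 0 <= hratio x y -> hratio x y < hratio z w ->
  gker c x y < gker c z w.
Proof.
move=> c0 h0 h; rewrite ltr_pM2l ?divr_gt0// ltr_ln ?posrE; lra.
Qed.

Lemma gker_gt0 c x y : 0 < c -> 0 < height x -> 0 < height y -> x != y -> 0 < gker c x y.
Proof.
move=> c0 hx hy xy; rewrite mulr_gt0 ?divr_gt0// ln_gt0// ltrDl mulr_gt0//.
by rewrite divr_gt0 ?mulr_gt0// sqn_gt0 subr_eq0.
Qed.

Lemma measurable_height : measurable_fun setT height.
Proof. exact: measurable_coord. Qed.

Lemma measurable_gker c x : measurable_fun setT (gker c x).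
Proof.
apply: measurable_funM => //; apply: (measurableT_comp (@measurable_ln R)).
apply: measurable_funD => //; apply: measurable_funM => //.
apply: measurable_funM.
  by apply: measurable_funM => //; exact: measurable_height.
apply: measurable_fun_inv.
by apply: measurable_fun_sqn; apply: measurable_rVB.
Qed.

Section sphere_inversion.
Variable l : R.
Hypothesis l0 : 0 < l.

Lemma height_sphinv x : height (sphinv l x) = l ^+ 2 / sqn x * height x.
Proof. by rewrite /height mxE. Qed.

Lemma height_sphinv_gt0 x : 0 < height x -> 0 < height (sphinv l x).
Proof.
move=> hx; rewrite height_sphinv mulr_gt0// divr_gt0 ?exprn_gt0// sqn_gt0.
exact: half_space_neq0.
Qed.

Lemma sqn_sphinvB x y : x != 0 -> y != 0 ->
  sqn (sphinv l x - sphinv l y) = l ^+ 4 / (sqn x * sqn y) * sqn (x - y).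
Proof.
rewrite -!sqn_gt0 => x0 y0.
rewrite !sqnB /sphinv !sqnZ dotZl dotZr.
by field; rewrite !gt_eqF.
Qed.

Lemma ratio_sphinv x y : x != 0 -> y != 0 ->
  hratio (sphinv l x) (sphinv l y) = hratio x y.
Proof.
move=> x0 y0; rewrite /hratio sqn_sphinvB// !height_sphinv.
have [->|xy] := eqVneq x y.
  by rewrite subrr (eqP (_ : sqn 0 == 0)) ?sqn_eq0// mulr0 invr0 !mulr0.
have xy0 : sqn (x - y) != 0 by rewrite sqn_eq0 subr_eq0.
move: x0 y0; rewrite -!sqn_eq0 => x0 y0.
by field; rewrite xy0 x0 y0 gt_eqF.
Qed.

Lemma gker_sphinv c x y : x != 0 -> y != 0 ->
  gker c (sphinv l x) (sphinv l y) = gker c x y.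
Proof. by move=> x0 y0; rewrite /gker ratio_sphinv. Qed.

Lemma sphinv_neq0 x : x != 0 -> sphinv l x != 0.
Proof.
move=> x0; rewrite -sqn_gt0 sqn_sphinv// divr_gt0 ?exprn_gt0//.
by rewrite sqn_gt0.
Qed.

Lemma gker_sphinv_swap c x y : x != 0 -> y != 0 ->
  gker c (sphinv l x) y = gker c x (sphinv l y).
Proof.
move=> x0 y0; rewrite -(@gker_sphinv c x (sphinv l y)) ?sphinv_neq0// sphinvK//.
by rewrite gt_eqF.
Qed.

(** From |x - y'|^2 |y|^2 / l^2 = |x - y|^2 + (l^2 - |x|^2)(l^2 - |y|^2) / l^2 with y' the image of
    [y]. The sign of the last term decides which of [y] and y' has the larger kernel. *)
Lemma ratio_sphinv_r x y : y != 0 -> sqn (x - sphinv l y) != 0 ->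
  hratio x (sphinv l y) =
  height x * height y /
    (sqn (x - y) + (l ^+ 2 - sqn x) * (l ^+ 2 - sqn y) / l ^+ 2).
Proof.
rewrite -sqn_gt0 => y0 xy.
have E : sqn (x - y) + (l ^+ 2 - sqn x) * (l ^+ 2 - sqn y) / l ^+ 2 =
    sqn (x - sphinv l y) * sqn y / l ^+ 2.
  rewrite !sqnB /sphinv !sqnZ dotZr.
  by field; rewrite !gt_eqF.
rewrite E /hratio height_sphinv.
by field; rewrite xy !gt_eqF.
Qed.

Lemma gker_sphinv_lt c x y : 0 < c -> 0 < height x -> 0 < height y ->
  sqn x < l ^+ 2 -> sqn y < l ^+ 2 -> x != y ->
  gker c x (sphinv l y) < gker c x y.
Proof.
move=> c0 hx hy xl yl xy.
have y0 : y != 0 by exact: half_space_neq0.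
have xy0 : 0 < sqn (x - y) by rewrite sqn_gt0 subr_eq0.
have d0 : 0 < (l ^+ 2 - sqn x) * (l ^+ 2 - sqn y) / l ^+ 2.
  by rewrite divr_gt0 ?mulr_gt0 ?subr_gt0 ?exprn_gt0.
apply: gker_lt => //.
  by apply: ratio_ge0; rewrite ltW// height_sphinv_gt0.
(* If the image of [y] were [x], the ratio on the left would be 0 by division by zero, so the
   inequality holds there too. *)
have [E|E] := eqVneq (sqn (x - sphinv l y)) 0.
  by rewrite {1}/hratio E invr0 mulr0 divr_gt0 ?mulr_gt0.
rewrite ratio_sphinv_r// /hratio ltr_pM2l ?mulr_gt0// ltf_pV2 ?posrE//; lra.
Qed.

End sphere_inversion.

(** The inequality ln t <= t^e / e trades the logarithm for an arbitrarily small power. The constant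
    8 lam^2 bounds |x - y|^2 plus 4 times the product of the heights, each of the two being at most
    4 lam^2. *)
Lemma gker_le_powR c e (lam : R) x y : 0 <= c -> 0 < e -> 0 < height x -> 0 < height y ->
  sqn x <= lam ^+ 2 -> sqn y <= lam ^+ 2 ->
  gker c x y <= c / (2 * e) * (8 * lam ^+ 2) `^ e * sqn (x - y) `^ (- e).
Proof.
move=> c0 e0 hx hy xl yl.
have [->|xy] := eqVneq x y.
  rewrite /gker /hratio subrr (eqP (_ : sqn 0 == 0)) ?sqn_eq0// invr0 !mulr0 addr0 ln1 mulr0.
  by apply: mulr_ge0; [apply: mulr_ge0|]; rewrite ?powR_ge0// divr_ge0// mulr_ge0// ltW.
have q0 : 0 < sqn (x - y) by rewrite sqn_gt0 subr_eq0.
have r0 : 0 < 1 + 4 * hratio x y.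
  by have := ratio_ge0 (ltW hx) (ltW hy); lra.
have h2 z : height z ^+ 2 <= sqn z by exact: sqr_coord_le_sqn.
have hxy : height x * height y <= lam ^+ 2.
  have := h2 x; have := h2 y; have := sqr_ge0 (height x - height y).
  by rewrite sqrrB; lra.
have q4 : sqn (x - y) <= 4 * lam ^+ 2.
  have : 0 <= sqn (x + y) by exact: sqn_ge0.
  by move: xl yl; rewrite sqnB /sqn dotDl !dotDr (dotC y x) -/(sqn x) -/(sqn y); lra.
have hr : 1 + 4 * hratio x y <= 8 * lam ^+ 2 * (sqn (x - y))^-1.
  have E : hratio x y * sqn (x - y) = height x * height y by rewrite divfK ?gt_eqF.
  by rewrite ler_pdivlMr// mulrDl mul1r -[4 * _ * _]mulrA E; lra.
have le1 : ln (1 + 4 * hratio x y) <= (8 * lam ^+ 2) `^ e * sqn (x - y) `^ (- e) / e.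
  rewrite ler_pdivlMr// mulrC -ln_powR.
  apply: (le_trans (ltW (ln_sublinear (powR_gt0 _ r0)))).
  rewrite powRN -powR_inv1 ?powR_ge0// -powRrM [e * -1]mulrC powRrM powR_inv1 ?(ltW q0)//.
  have L0 : 0 <= 8 * lam ^+ 2 by rewrite mulr_ge0// sqr_ge0.
  rewrite -powRM ?invr_ge0 ?(ltW q0)//.
  by apply: ge0_ler_powR => //; rewrite ?nnegrE ltW//; exact: lt_le_trans hr.
have -> : c / (2 * e) * (8 * lam ^+ 2) `^ e * sqn (x - y) `^ (- e) =
    c / 2 * ((8 * lam ^+ 2) `^ e * sqn (x - y) `^ (- e) / e).
  by field; rewrite gt_eqF.
by rewrite ler_wpM2l// divr_ge0.
Qed.

End kernel.

(** * Solutions on the half space *)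

Section half_space_solution.
Context {R : realType}.
Variable n : nat.
Implicit Types x y : 'rV[R]_n.+1.
Let H := @half_space R n.
Let mu := @lebesgue_rV R n.+1.

Lemma open_half_space : open H.
Proof.
have -> : H = (fun x => x 0 ord_max) @^-1` [set r : R | 0 < r] by [].
by apply: open_comp; [move=> x _; exact: coord_continuous|exact: open_gt].
Qed.

Lemma measurable_half_space : measurable H.
Proof.
have -> : H = [set: 'rV[R]_n.+1] `&` [set x | (fun x => 0 < height x) x].
  by rewrite setTI.
apply: (measurable_fun_ltr (f := fun=> 0) (g := @height R n)) => //.
exact: measurable_height.
Qed.

Lemma cube0 x : cube x 0 = [set x].
Proof.
apply/seteqP; split => y /=; last first.
  by move=> ->; apply/cubeP => i; rewrite subrr normr0.
move=> /cubeP h; apply/rowP => i; apply/eqP; rewrite eq_sym -subr_eq0 -normr_eq0.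
by rewrite eq_le normr_ge0 andbT.
Qed.

Lemma measurable_point x : measurable [set x].
Proof. by rewrite -cube0; exact: measurable_cube. Qed.

Lemma lebesgue_rV_point x : mu [set x] = 0%E.
Proof. by rewrite -cube0 lebesgue_rV_cube// mulr0 expr0n. Qed.

Lemma cube_ball x (e : R) : 0 < e -> cube x (e / 2) `<=` ball x e.
Proof.
move=> e0 y /cubeP h; rewrite -ball_normE /= [ltLHS]/Num.norm /= mx_normrE.
apply: (@le_lt_trans _ _ (e / 2)); last by lra.
by apply/bigmax_leP; split; [rewrite divr_ge0// ltW|move=> [i j] _ /=; rewrite ord1 !mxE].
Qed.

Lemma compact_closed_cube (A : set 'rV[R]_n.+1) (r : R) : closed A ->
  compact (A `&` [set v : 'rV[R]_n.+1 | forall i, v ord0 i \in `[- r, r]]).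
Proof.
move=> cA; rewrite setIC; apply: compact_closedI => //.
apply: (@rV_compact _ _ (fun=> `[- r, r]%classic)).
by move=> _; exact: segment_compact.
Qed.

Variables (C p a : R) (u : 'rV[R]_n.+1 -> R).
Hypothesis C0 : 0 < C.
Hypothesis u_cont : {within closure H, continuous u}.
Hypothesis u_sol : integral_solution C p a u.

Lemma cont_half_space x : H x -> u y @[y --> x] --> u x.
Proof.
move=> hx.
have : {within H, continuous u}.
  by apply: continuous_subspaceW u_cont; exact: subset_closure.
rewrite continuous_open_subspace; last exact: open_half_space.
by apply; rewrite inE.
Qed.

(** Continuity up to the boundary is essential: the compact set on which the maximum is taken
    contains boundary points, among them 0. *)
Lemma bounded_half_space (r : R) : exists2 M, 0 < M &
  forall y, H y -> sqn y <= r ^+ 2 -> u y <= M.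
Proof.
pose K := closure H `&` [set v : 'rV[R]_n.+1 | forall i, v ord0 i \in `[- `|r|, `|r|]].
have cK : compact K by apply: compact_closed_cube; exact: closed_closure.
have cuK : {within K, continuous u}.
  by apply: continuous_subspaceW u_cont; exact: subIsetl.
have [K0|K0] := pselect (K !=set0); last first.
  exists 1 => // y hy yr; exfalso; apply: K0; exists y; split; first exact: subset_closure.
  move=> i; rewrite in_itv /= -ler_norml -ler_sqr ?nnegrE// !real_normK ?num_real//.
  exact: le_trans (sqr_coord_le_sqn _ _) yr.
have [x _ hx] := EVT_max_rV K0 cK cuK.
exists (`|u x| + 1); first by rewrite ltr_wpDl.
move=> y hy yr; apply: (@le_trans _ _ (u x)); last first.
  by apply: (le_trans (ler_norm _)); rewrite lerDl.
apply: hx; rewrite inE; split; first exact: subset_closure.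
move=> i; rewrite in_itv /= -ler_norml -ler_sqr ?nnegrE// !real_normK ?num_real//.
exact: le_trans (sqr_coord_le_sqn _ _) yr.
Qed.

Lemma eq0_closure : (forall x, H x -> u x = 0) -> forall x, closure H x -> u x = 0.
Proof.
move=> u0 x hx; apply/eqP; apply: contraT => ux.
have /subspace_continuousP /(_ _ hx) /cvgrPdist_lt := u_cont.
have ux0 : 0 < `|u x| by rewrite normr_gt0.
move=> /(_ _ ux0); rewrite near_withinE => nx.
have [y [hy ny]] := hx _ nx.
have := ny (subset_closure hy); rewrite /from_subspace /= (u0 _ hy) subr0.
by rewrite ltxx.
Qed.

(** The extension by 0 lets all integrals run over the whole space, where the change of variables is
    stated. *)
Definition source y : R := if 0 < height y then sqn y `^ (a / 2) * u y `^ p else 0.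

Lemma source_ge0 y : 0 <= source y.
Proof. by rewrite /source; case: ifPn => // _; rewrite mulr_ge0 ?powR_ge0. Qed.

Let e0 : 'rV[R]_n.+1 := \row_i 1.
Let He0 : H e0. Proof. by rewrite /H /half_space /= mxE ltr01. Qed.

(* The measurability of u is only available through that of the integrand,
   which is part of the integrability assumption. *)
Lemma measurable_source : measurable_fun setT source.
Proof.
have [/integrableP[+ _] _] := u_sol He0.
move=> /(measurable_restrictT _ measurable_half_space).
set F := (X in X \_ _) => mF.
have mE : measurable_fun setT (fun y => y == e0).
  have -> : (fun y => y == e0) = (fun y => sqn (e0 - y) == 0).
    by apply/funext => y; rewrite sqn_eq0 subr_eq0 eq_sym.
  apply: measurable_fun_eqr => //.
  by apply: measurable_fun_sqn; apply: measurable_rVB.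
pose f0 y := green C e0 y * enorm y `^ a * u y `^ p.
have mf0 : measurable_fun setT (f0 \_ H).
  apply/measurable_EFinP; move: mF; congr (measurable_fun _ _).
  by apply/funext => y; rewrite /patch /=; case: ifPn.
(* Dividing the integrand for the point [e0] by the positive kernel recovers the source. At the pole
   [e0], where [gker] is 0, the value is put in by hand. *)
have -> : source = (fun y => if y == e0 then source e0 else (f0 \_ H) y * (gker C e0 y)^-1).
  apply/funext => y; case: eqVneq => [->//|ye].
  rewrite /patch; case: ifPn; rewrite (inE, notin_setE) => hy; last first.
    by rewrite mul0r /source ifF//; apply/negbTE/negP.
  rewrite /source ifT// /f0 green_gker//; last by rewrite eq_sym.
  have g0 : 0 < gker C e0 y by apply: gker_gt0 => //; rewrite eq_sym.
  by rewrite enorm_powR; field; rewrite gt_eqF.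
apply: measurable_fun_ifT => //; apply: measurable_funM => //.
by apply: measurable_fun_inv; exact: measurable_gker.
Qed.

Lemma gker_source_ge0 x y : H x -> 0 <= gker C x y * source y.
Proof.
move=> hx; rewrite /source; case: ifPn => hy; last by rewrite mulr0.
by rewrite mulr_ge0 ?gker_ge0 ?mulr_ge0 ?powR_ge0 ?ltW.
Qed.

Lemma measurable_gker_source x : measurable_fun setT (fun y => gker C x y * source y).
Proof. by apply: measurable_funM; [exact: measurable_gker|exact: measurable_source]. Qed.

Lemma integral_gker_source x : H x ->
  ((u x)%:E = \int[mu]_y (gker C x y * source y)%:E)%E.
Proof.
move=> hx; have [iF ->] := u_sol hx.
rewrite /Rintegral fineK; last by apply: integrable_fin_num => //; exact: measurable_half_space.
have mG : measurable_fun H (EFin \o (fun y => gker C x y * source y)).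
  by apply: measurable_funTS; apply/measurable_EFinP; exact: measurable_gker_source.
rewrite (@ae_eq_integral _ _ _ mu H (EFin \o (fun y => gker C x y * source y)))//; last 3 first.
- exact: measurable_half_space.
- by case/integrableP: iF.
(* The two kernels may differ at y = x, by their default values; a single point is null. *)
- exists [set x]; split; [exact: measurable_point|exact: lebesgue_rV_point|].
  move=> y /=; apply: contra_notP => yx hy.
  congr EFin; rewrite green_gker//; last by apply/eqP => xy; exact: yx.
  by rewrite /source ifT// enorm_powR mulrA.
rewrite [LHS]integral_mkcond; apply: eq_integral => y _.
rewrite /patch; case: ifPn => //; rewrite notin_setE => hy.
by rewrite /source ifF ?mulr0//; apply/negbTE/negP.
Qed.

End half_space_solution.

Lemma integral_gt0 d (T : measurableType d) (R : realType)
    (mu : {measure set T -> \bar R}) (g : T -> R) (A : set T) :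
  measurable_fun setT g -> (forall y, 0 <= g y) -> measurable A ->
  mu A != 0%E -> (forall y, A y -> 0 < g y) -> (0 < \int[mu]_y (g y)%:E)%E.
Proof.
move=> mg g0 mA muA gA; rewrite lt0e integral_ge0 ?andbT; last first.
  by move=> y _; rewrite lee_fin.
apply: contra muA => /eqP I0; apply/eqP.
have : ae_eq mu setT (EFin \o g) (cst 0%E).
  apply/ae_eq_integral_abs => //; first exact/measurable_EFinP.
  by rewrite -[RHS]I0; apply: eq_integral => y _ /=; rewrite ger0_norm.
move=> ae; apply: measure_negligible => //; apply: negligibleS ae => y Ay /= H.
by have := gA y Ay; have [->] := H Logic.I; rewrite ltxx.
Qed.

Lemma ereal_cancel_le (R : realType) (U V X Y Z : \bar R) : X \is a fin_num ->
  (U + X = V + Y)%E -> (Y <= Z + X)%E -> (U <= V + Z)%E.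
Proof. by move=> Xfin E YZ; rewrite -(leeD2rE _ _ Xfin) E -addeA leeD2l. Qed.

Lemma ereal_cancel_lt (R : realType) (U V : R) (Y Z : \bar R) : (Y + Z)%E \is a fin_num ->
  (U%:E + (Y + Z) = V%:E + Y)%E -> (0 < Z)%E -> U < V.
Proof.
case: Y => [y| |]; case: Z => [z| |] //= _ [] E; rewrite lte_fin; lra.
Qed.

(** * Balls and spheres of R^(n+1) *)

Section space.
Context {R : realType}.
Variable n : nat.
Implicit Types x y : 'rV[R]_n.+1.
Let mu := @lebesgue_rV R n.+1.

Lemma sqn_continuous : continuous (@sqn R n.+1).
Proof.
move=> x; rewrite /sqn /dot.
apply: (@continuous_big _ _ +%R) => //= [|i _ y]; first exact: add_continuous.
by apply: continuousM; exact: coord_continuous.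
Qed.

Definition eball (r : R) : set 'rV[R]_n.+1 := [set y | sqn y < r ^+ 2].

Lemma measurable_eball (r : R) : measurable (eball r).
Proof.
have : measurable_fun setT (fun y : 'rV[R]_n.+1 => sqn y < r ^+ 2).
  by apply: measurable_fun_ltr => //; exact: measurable_fun_sqn.
by move=> /(_ measurableT [set true] Logic.I); rewrite setTI.
Qed.

Lemma open_eball (r : R) : open (eball r).
Proof.
have -> : eball r = @sqn R n.+1 @^-1` [set t : R | t < r ^+ 2] by [].
by apply: open_comp; [move=> y _; exact: sqn_continuous|exact: open_lt].
Qed.

Lemma open_measure_neq0 (A : set 'rV[R]_n.+1) x (B : set 'rV[R]_n.+1) :
  open B -> B x -> measurable A -> B `<=` A -> mu A != 0%E.
Proof.
move=> oB Bx mA BA.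
have /nbhs_ballP [e e0 he] : nbhs x B by exact: open_nbhs_nbhs.
have e20 : 0 < e / 2 by rewrite divr_gt0.
have : (0 < mu (cube x (e / 2)))%E.
  by rewrite lebesgue_rV_cube ?ltW// lte_fin exprn_gt0// mulr_gt0.
move=> h; rewrite gt_eqF//; apply: (lt_le_trans h).
apply: le_measure; rewrite ?inE//; first exact: measurable_cube.
by apply: subset_trans BA; apply: subset_trans he; exact: cube_ball.
Qed.

Lemma measure_setD_point (A : set 'rV[R]_n.+1) x : measurable A ->
  mu A != 0%E -> mu (A `\` [set x]) != 0%E.
Proof.
move=> mA; apply: contra => /eqP h; apply/eqP/eqP; rewrite -measure_le0.
have mp := measurable_point x.
have mD : measurable (A `\` [set x]) by exact: measurableD.
apply: (@le_trans _ _ (mu (A `\` [set x] `|` [set x]))).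
  apply: le_measure; rewrite ?inE//; first exact: measurableU.
  by move=> y Ay; have [->|/eqP yx] := eqVneq y x; [right|left].
apply: (le_trans (measureU2 mu mD mp)); rewrite -[leRHS]adde0.
apply: leeD; rewrite le_eqVlt; apply/orP; left; apply/eqP; first exact: h.
exact: lebesgue_rV_point.
Qed.

Lemma eball_cube (r : R) : 0 <= r -> eball r `<=` cube 0 r.
Proof.
move=> r0 y yr; apply: cube_sqn => //.
by rewrite sub0r /sqn dotNl dotNr opprK ltW.
Qed.

Lemma lebesgue_rV_eball_le (r : R) : 0 <= r -> (mu (eball r) <= ((2 * r) ^+ n.+1)%:E)%E.
Proof.
move=> r0; rewrite -(lebesgue_rV_cube 0 r0).
apply: le_measure; rewrite ?inE; [exact: measurable_eball|exact: measurable_cube|].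
exact: eball_cube.
Qed.

Lemma lebesgue_rV_eball (r : R) : 0 < r ->
  mu (eball r) = ((r ^+ n.+1)%:E * mu (eball 1))%E.
Proof.
move=> r0; have E s : mu (eball s) = (\int[mu]_y (\1_(eball s) y)%:E)%E.
  by rewrite integral_indic ?setIT//; exact: measurable_eball.
rewrite !E (ge0_integral_scale r0).
- congr (_ * _)%E; apply: eq_integral => y _; rewrite !indicE; congr (_%:R%:E).
  have -> : (r *: y \in eball r) = (y \in eball 1); last by [].
  have h : (sqn (r *: y) < r ^+ 2) = (sqn y < 1 ^+ 2).
    by rewrite sqnZ expr1n -[X in _ < X]mulr1 ltr_pM2l// exprn_gt0.
  by apply/idP/idP; rewrite !inE => yr; [rewrite -[eball 1 y]/(is_true (sqn y < 1 ^+ 2)) -h|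
    rewrite -[eball r _]/(is_true (sqn (r *: y) < r ^+ 2)) h].
- by apply/measurable_EFinP; apply: measurable_indic; exact: measurable_eball.
- by move=> y; rewrite lee_fin indicE ler0n.
Qed.

(* The sphere is contained in the difference of the balls of radii t r and r,
   whose measure is proportional to t^(n+1) - 1. *)
Lemma lebesgue_rV_sphere (r : R) : 0 < r -> mu [set y | sqn y = r ^+ 2] = 0%E.
Proof.
move=> r0; set S := [set y | _].
have mS : measurable S.
  have : measurable_fun setT (fun y : 'rV[R]_n.+1 => sqn y == r ^+ 2).
    by apply: measurable_fun_eqr => //; exact: measurable_fun_sqn.
  move=> /(_ measurableT [set true] Logic.I); rewrite setTI.
  by congr measurable; apply/seteqP; split => y /= /eqP.
have fB : mu (eball 1) \is a fin_num.
  by rewrite ge0_fin_numE//; apply: le_lt_trans (lebesgue_rV_eball_le ler01) (ltry _).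
pose m := fine (mu (eball 1)).
have mE s : 0 < s -> mu (eball s) = (s ^+ n.+1 * m)%:E.
  by move=> s0; rewrite lebesgue_rV_eball// EFinM fineK.
have m0 : 0 <= m by rewrite fine_ge0.
have SB t : 1 < t -> (mu S + (r ^+ n.+1 * m)%:E <= ((t * r) ^+ n.+1 * m)%:E)%E.
  move=> t1; have t0 : 0 < t by exact: lt_trans t1.
  rewrite -(mE r r0) -(mE (t * r) (mulr_gt0 t0 r0)) -measureU//; last 2 first.
  - exact: measurable_eball.
  - apply/seteqP; split => // y [yr].
    by rewrite -[eball r y]/(is_true (sqn y < r ^+ 2)) (yr : sqn y = _) ltxx.
  apply: le_measure; rewrite ?inE.
  - by apply: measurableU => //; exact: measurable_eball.
  - exact: measurable_eball.
  have rt : r ^+ 2 < (t * r) ^+ 2.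
    by rewrite ltr_sqr ?nnegrE ?mulr_ge0 ?ltW// -[X in X < _]mul1r ltr_pM2r.
  move=> y [yr|h]; first by rewrite -[eball _ y]/(is_true (sqn y < _ ^+ 2)) (yr : sqn y = _).
  exact: (lt_trans (h : sqn y < r ^+ 2) rt).
have fS : mu S \is a fin_num.
  rewrite ge0_fin_numE//; apply: (@le_lt_trans _ _ ((2 * r) ^+ n.+1 * m)%:E); last exact: ltry.
  apply: le_trans (SB 2 _); last by rewrite ltr1n.
  by apply: leeDl; rewrite lee_fin mulr_ge0// exprn_ge0// ltW.
apply/eqP; apply: contraT => S0.
pose s := fine (mu S).
have s0 : 0 < s by rewrite fine_gt0// lt0e S0 measure_ge0 /= -ge0_fin_numE.
pose K := r ^+ n.+1 * m.
have K0 : 0 <= K by rewrite mulr_ge0// exprn_ge0// ltW.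
have ineq t : 1 < t -> s + K <= t ^+ n.+1 * K.
  by move=> /SB; rewrite -(fineK fS) -EFinD lee_fin exprMn mulrA.
(* For t^(n+1) = 1 + q the inequality reads s <= q K, whereas q (K + 1) = s / 2. The summand 1 keeps
   the denominator positive when K = 0. *)
pose q := s / (2 * (K + 1)).
have q0 : 0 < q by rewrite divr_gt0// mulr_gt0//; lra.
have t1 : 1 < (1 + q) `^ (n.+1%:R)^-1.
  have : (1 : R) `^ (n.+1%:R)^-1 < (1 + q) `^ (n.+1%:R)^-1.
    by rewrite gt0_ltr_powR ?invr_gt0 ?ltr0n ?nnegrE//; lra.
  by rewrite powR1.
have := ineq _ t1.
rewrite -powR_mulrn ?powR_ge0// -powRrM mulVf ?pnatr_eq0// powRr1; last by lra.
have qK : q * (K + 1) = s / 2 by rewrite /q; field; lra.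
by nra.
Qed.

End space.

(** An integer k >= p stands in for the constant p of the mean value theorem: with t = v/u in
    [0, 1], 1 - t^p <= 1 - t^k <= k (1 - t) by Bernoulli's inequality. *)
Lemma powR_lipschitz (R : realType) (M p u v : R) (k : nat) :
  1 <= p -> p <= k%:R -> 0 <= v -> v <= u -> u <= M ->
  u `^ p - v `^ p <= k%:R * M `^ (p - 1) * (u - v).
Proof.
move=> p1 pk v0 vu uM.
have p0 : 0 < p by lra.
have [u0|u0] := eqVneq u 0.
  have -> : v = 0 by lra.
  by rewrite u0 powR0 ?gt_eqF// !subrr mulr0.
have {}u0 : 0 < u by rewrite lt_def u0 (le_trans v0).
pose t := v / u.
have t0 : 0 <= t by rewrite divr_ge0// ltW.
have t1 : t <= 1 by rewrite ler_pdivrMr// mul1r.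
have k1 : (0 < k)%N by rewrite -(ltr_nat R); exact: lt_le_trans pk.
have tk : t ^+ k <= t `^ p.
  have [->|tn0] := eqVneq t 0; first by rewrite expr0n gtn_eqF//= powR_ge0.
  rewrite -powR_mulrn// ger_powR// t1 andbT lt_def tn0//.
have bern (j : nat) : 1 + j%:R * (t - 1) <= t ^+ j.
  elim: j => [|j IH]; first by rewrite mul0r addr0 expr0.
  have := exprn_ile1 j t0 t1; rewrite exprS -natr1 => tj.
  by nra.
have bk := bern k.
have -> : v = t * u by rewrite divfK// gt_eqF.
rewrite powRM ?(ltW u0)//.
have up : u `^ p = u `^ (p - 1) * u.
  rewrite -{3}(powRr1 (ltW u0)) -powRD ?subrK//.
  by apply/implyP => _; rewrite gt_eqF.
have uM1 : u `^ (p - 1) <= M `^ (p - 1).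
  by rewrite ge0_ler_powR ?nnegrE ?(ltW u0)//; lra.
have -> : u `^ p - t `^ p * u `^ p = u `^ (p - 1) * (u * (1 - t `^ p)).
  by rewrite up; ring.
have -> : k%:R * M `^ (p - 1) * (u - t * u) = M `^ (p - 1) * (u * (k%:R * (1 - t))).
  by ring.
apply: (@le_trans _ _ (u `^ (p - 1) * (u * (k%:R * (1 - t))))).
  rewrite ler_wpM2l ?powR_ge0// ler_wpM2l ?(ltW u0)//; lra.
by rewrite ler_wpM2r// !mulr_ge0 ?(ltW u0) ?subr_ge0.
Qed.

(** Both sides are reordered into the same sum, so that no extended real is subtracted; [X] is
    finite as a nonnegative part of the finite value [V]. *)
Lemma ereal_exchange (R : realType) (U V : R) (a' Y s b X : \bar R) :
  (U%:E = a' + Y + s + b)%E -> (V%:E = a' + s + (b + X))%E ->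
  (0 <= a')%E -> (0 <= s)%E -> (0 <= b)%E -> (0 <= X)%E ->
  (U%:E + X = V%:E + Y)%E /\ X \is a fin_num.
Proof.
move=> E1 E2 a0 s0 b0 X0; split.
  rewrite E1 E2 -(addeA a' Y s) (addeC Y s) !addeA.
  by rewrite (addeAC (a' + s)%E Y b) (addeAC (a' + s + b)%E Y X).
rewrite ge0_fin_numE//; apply: le_lt_trans (ltry V).
by rewrite E2 addeA; apply: leeDr; apply: adde_ge0 => //; apply: adde_ge0.
Qed.

(** * Scaling spheres *)

#[local] Opaque gker sphinv sqn.

Section scaling_spheres.
Context {R : realType}.
Variable n : nat.
Implicit Types x y z : 'rV[R]_n.+1.
Let H := @half_space R n.
Let mu := @lebesgue_rV R n.+1.
Variables (C p a : R) (u : 'rV[R]_n.+1 -> R).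
Hypothesis C0 : 0 < C.
Let f := source p a u.
Hypothesis mf : measurable_fun setT f.
Hypothesis uE : forall x, H x -> ((u x)%:E = \int[mu]_y (gker C x y * f y)%:E)%E.

Let f_ge0 y : 0 <= f y. Proof. exact: source_ge0. Qed.

Let gf_ge0 x y : H x -> 0 <= gker C x y * f y.
Proof. by move=> hx; exact: gker_source_ge0. Qed.

Section sphere.
Variable l : R.
Hypothesis l0 : 0 < l.
Let J y : R := (l ^+ 2 / sqn y) ^+ n.+1.

Let J_ge0 y : 0 <= J y.
Proof. by rewrite exprn_ge0// divr_ge0 ?sqr_ge0 ?sqn_ge0. Qed.

Let mJ : measurable_fun setT J.
Proof.
apply: measurable_funX; apply: measurable_funM => //.
apply: measurable_fun_inv.
exact: measurable_fun_sqn.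
Qed.

Let ker_ge0 x y : H x -> H y -> 0 <= gker C x y.
Proof. by move=> hx hy; rewrite gker_ge0// ltW. Qed.

(** The density that the source outside the ball induces inside it after the inversion, Jacobian
    included. *)
Definition reflected_source y : R := J y * f (sphinv l y).
Let F := reflected_source.

Let mF : measurable_fun setT F.
Proof.
by apply: measurable_funM => //; exact: measurableT_comp mf (@measurable_sphinv _ _ l).
Qed.

Let F_ge0 y : 0 <= F y. Proof. by rewrite mulr_ge0. Qed.

Lemma height_sphinv_le0 y : ~~ (0 < height y) -> ~~ (0 < height (sphinv l y)).
Proof.
rewrite -!leNgt => hy; rewrite height_sphinv.
by rewrite mulr_ge0_le0// divr_ge0 ?sqr_ge0 ?sqn_ge0.
Qed.

Let f_out y : ~~ (0 < height y) -> f y = 0.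
Proof. by rewrite /f /source => /negPf ->. Qed.

Let F_out y : ~~ (0 < height y) -> F y = 0.
Proof. by move=> hy; rewrite /F /reflected_source f_out ?mulr0// height_sphinv_le0. Qed.

Section point.
Variable x : 'rV[R]_n.+1.
Hypothesis hx : H x.
Hypothesis xl : sqn x < l ^+ 2.

(* Since gker vanishes at its pole, x is removed from the ball, and its image
   from the exterior. *)
Let chib y : R := ((sqn y < l ^+ 2) && (y != x))%R%:R.
Let chio y : R := ((l ^+ 2 < sqn y) && (y != sphinv l x))%R%:R.
Let chis y : R := (sqn y == l ^+ 2)%R%:R.

Let measurable_neq z : measurable_fun setT (fun y => y != z).
Proof.
have -> : (fun y => y != z) = (fun y => 0 < sqn (z - y)).
  by apply/funext => y; rewrite sqn_gt0 subr_eq0 eq_sym.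
apply: measurable_fun_ltr => //.
by apply: measurable_fun_sqn; apply: measurable_rVB.
Qed.

Let msq : measurable_fun setT (fun y => sqn y).
Proof. exact: measurable_fun_sqn. Qed.

Let mchib : measurable_fun setT chib.
Proof.
apply: measurable_fun_natr; apply: measurable_and; last exact: measurable_neq.
exact: measurable_fun_ltr.
Qed.

Let mchio : measurable_fun setT chio.
Proof.
apply: measurable_fun_natr; apply: measurable_and; last exact: measurable_neq.
exact: measurable_fun_ltr.
Qed.

Let mchis : measurable_fun setT chis.
Proof. by apply: measurable_fun_natr; exact: measurable_fun_eqr. Qed.

Let chib_ge0 y : 0 <= chib y. Proof. by rewrite ler0n. Qed.
Let chio_ge0 y : 0 <= chio y. Proof. by rewrite ler0n. Qed.
Let chis_ge0 y : 0 <= chis y. Proof. by rewrite ler0n. Qed.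

Let mgk z : measurable_fun setT (gker C z). Proof. exact: measurable_gker. Qed.
Let mgkI z : measurable_fun setT (fun y => gker C z (sphinv l y)).
Proof. exact: measurableT_comp (mgk z) (@measurable_sphinv _ _ l). Qed.

Let gfb_ge0 z y : H z -> 0 <= gker C z y * f y * chib y.
Proof. by move=> hz; rewrite mulr_ge0// gf_ge0. Qed.
Let gfs_ge0 z y : H z -> 0 <= gker C z y * f y * chis y.
Proof. by move=> hz; rewrite mulr_ge0// gf_ge0. Qed.
Let gfo_ge0 z y : H z -> 0 <= gker C z y * f y * chio y.
Proof. by move=> hz; rewrite mulr_ge0// gf_ge0. Qed.

(** The exterior is folded into the ball by the inversion. The sphere keeps its own term: the
    inversion fixes its points, so this term is the same for [x] and for its image and cancels. *)
Let decomp z : H z ->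
  ((u z)%:E = \int[mu]_y (gker C z y * f y * chib y)%:E
            + \int[mu]_y (gker C z y * f y * chis y)%:E
            + \int[mu]_y (gker C z (sphinv l y) * F y * chib y)%:E)%E.
Proof.
move=> hz; rewrite uE//.
have mgf : measurable_fun setT (fun y => gker C z y * f y) by exact: measurable_funM.
have -> : (\int[mu]_y (gker C z (sphinv l y) * F y * chib y)%:E =
    \int[mu]_y (gker C z y * f y * chio y)%:E)%E.
  rewrite [RHS](ge0_integral_sphinv l0)//; last 3 first.
  - by apply/measurable_EFinP; apply: measurable_funM.
  - by move=> y; rewrite lee_fin gfo_ge0.
  - by rewrite f_out ?mulr0 ?mul0r// /height mxE ltxx.
  apply: eq_integral => y _; rewrite -EFinM; congr EFin.
  have [->|y0] := eqVneq y 0.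
    rewrite F_out ?mulr0 ?mul0r /height ?mxE ?ltxx// sphinv0.
    by rewrite f_out ?mulr0 ?mul0r// /height mxE ltxx.
  have -> : chio (sphinv l y) = chib y.
    rewrite /chio /chib; congr (nat_of_bool (_ && _))%:R.
      rewrite sqn_sphinv// ltr_pdivlMr ?sqn_gt0// (_ : l ^+ 4 = l ^+ 2 * l ^+ 2); last by ring.
      by rewrite ltr_pM2l// exprn_gt0.
    congr negb; apply/eqP/eqP => [E|->//].
    rewrite -[LHS](sphinvK (lt0r_neq0 l0) y0) E sphinvK ?lt0r_neq0//.
    exact: half_space_neq0.
  by rewrite /F /reflected_source -/(J y); ring.
rewrite -!ge0_integralD//=; last first.
all: try by move=> y _; rewrite ?adde_ge0 ?lee_fin ?gfb_ge0 ?gfs_ge0 ?gfo_ge0.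
all: try by (apply/measurable_EFinP; apply: measurable_funM).
  by apply: emeasurable_funD; apply/measurable_EFinP; apply: measurable_funM.
apply: ae_eq_integral => //; first exact/measurable_EFinP.
  apply: emeasurable_funD; last by apply/measurable_EFinP; apply: measurable_funM.
  by apply: emeasurable_funD; apply/measurable_EFinP; apply: measurable_funM.
have neg2 : mu.-negligible ([set x] `|` [set sphinv l x]).
  by apply: negligibleU; apply/(negligibleP mu (measurable_point _)); exact: lebesgue_rV_point.
apply: negligibleS neg2 => y /=; apply: contra_notP => /not_orP[/eqP yx /eqP yix] _.
rewrite -!EFinD -!mulrDr /chib /chis /chio yx yix !andbT; congr EFin.
by case: ltgtP => _; rewrite /= ?addr0 ?add0r mulr1.
Qed.

Definition sphere_kernel y : R := gker C x y - gker C x (sphinv l y).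
Let K := sphere_kernel.

Let mK : measurable_fun setT K. Proof. exact: measurable_funB. Qed.

Let hIx : H (sphinv l x). Proof. exact: height_sphinv_gt0. Qed.

Let K_gt0 y : 0 < height y -> sqn y < l ^+ 2 -> y != x -> 0 < K y.
Proof.
move=> hy yl yx; rewrite subr_gt0; apply: gker_sphinv_lt => //.
by rewrite eq_sym.
Qed.

Let Kchib_ge0 y : 0 < height y -> 0 <= K y * chib y.
Proof.
move=> hy; rewrite /chib; case: (boolP (_ && _)) => [/andP[yl yx]|_]; last by rewrite mulr0.
by rewrite mulr1 ltW// K_gt0.
Qed.

Let KF_ge0 y : 0 <= K y * F y * chib y.
Proof.
have [hy|hy] := boolP (0 < height y); last by rewrite F_out// mulr0 mul0r.
by rewrite mulrAC mulr_ge0// Kchib_ge0.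
Qed.

Let Kf_ge0 y : 0 <= K y * f y * chib y.
Proof.
have [hy|hy] := boolP (0 < height y); last by rewrite f_out// mulr0 mul0r.
by rewrite mulrAC mulr_ge0// Kchib_ge0.
Qed.

Let gIfb_ge0 y : 0 <= gker C x (sphinv l y) * f y * chib y.
Proof.
have [hy|hy] := boolP (0 < height y); last by rewrite f_out// mulr0 mul0r.
by apply: mulr_ge0 => //; apply: mulr_ge0 => //; apply: ker_ge0 => //; exact: height_sphinv_gt0.
Qed.

Let gIFb_ge0 y : 0 <= gker C x (sphinv l y) * F y * chib y.
Proof.
have [hy|hy] := boolP (0 < height y); last by rewrite F_out// mulr0 mul0r.
by apply: mulr_ge0 => //; apply: mulr_ge0 => //; apply: ker_ge0 => //; exact: height_sphinv_gt0.
Qed.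

Let swap_in : (\int[mu]_y (gker C (sphinv l x) y * f y * chib y)%:E =
  \int[mu]_y (gker C x (sphinv l y) * f y * chib y)%:E)%E.
Proof.
apply: eq_integral => y _; congr EFin.
have [hy|hy] := boolP (0 < height y); last by rewrite (f_out hy) !mulr0.
by rewrite (gker_sphinv_swap l0 C (half_space_neq0 hx) (half_space_neq0 hy)).
Qed.

Let swap_on : (\int[mu]_y (gker C (sphinv l x) y * f y * chis y)%:E =
  \int[mu]_y (gker C x y * f y * chis y)%:E)%E.
Proof.
apply: eq_integral => y _; congr EFin.
have [hy|hy] := boolP (0 < height y); last by rewrite (f_out hy) !mulr0.
rewrite (gker_sphinv_swap l0 C (half_space_neq0 hx) (half_space_neq0 hy)) /chis.
case: eqP => [E|_]; last by rewrite !mulr0.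
by rewrite (sphinv_id (lt0r_neq0 l0) E).
Qed.

Let mfb : measurable_fun setT (fun y => (gker C x (sphinv l y) * f y * chib y)%:E).
Proof.
by apply/measurable_EFinP; exact: (measurable_funM (measurable_funM (mgkI x) mf) mchib).
Qed.

Let mFb : measurable_fun setT (fun y => (gker C x (sphinv l y) * F y * chib y)%:E).
Proof.
by apply/measurable_EFinP; exact: (measurable_funM (measurable_funM (mgkI x) mF) mchib).
Qed.

Let mKf : measurable_fun setT (fun y => (K y * f y * chib y)%:E).
Proof. by apply/measurable_EFinP; exact: (measurable_funM (measurable_funM mK mf) mchib). Qed.

Let mKF : measurable_fun setT (fun y => (K y * F y * chib y)%:E).
Proof. by apply/measurable_EFinP; exact: (measurable_funM (measurable_funM mK mF) mchib). Qed.

Let swap_out : (\int[mu]_y (gker C (sphinv l x) (sphinv l y) * F y * chib y)%:E =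
  \int[mu]_y (gker C x (sphinv l y) * F y * chib y)%:E +
  \int[mu]_y (K y * F y * chib y)%:E)%E.
Proof.
rewrite -ge0_integralD; last 5 first.
- exact: measurableT.
- by move=> y _; rewrite lee_fin; exact: gIFb_ge0.
- exact: mFb.
- by move=> y _; rewrite lee_fin; exact: KF_ge0.
- exact: mKF.
apply: eq_integral => y _; rewrite -EFinD; congr EFin.
have [hy|hy] := boolP (0 < height y); last by rewrite (F_out hy) !(mulr0,mul0r,addr0).
rewrite (gker_sphinv l0 C (half_space_neq0 hx) (half_space_neq0 hy)).
by rewrite /K /sphere_kernel; ring.
Qed.

Let split_in : (\int[mu]_y (gker C x y * f y * chib y)%:E =
  \int[mu]_y (gker C x (sphinv l y) * f y * chib y)%:E +
  \int[mu]_y (K y * f y * chib y)%:E)%E.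
Proof.
rewrite -ge0_integralD; last 5 first.
- exact: measurableT.
- by move=> y _; rewrite lee_fin; exact: gIfb_ge0.
- exact: mfb.
- by move=> y _; rewrite lee_fin; exact: Kf_ge0.
- exact: mKf.
apply: eq_integral => y _; rewrite -EFinD; congr EFin.
by rewrite /K /sphere_kernel; ring.
Qed.

(** In [u x] the density [f] meets the kernel at y and [F] the kernel at the image of y; by
    invariance the two kernels are exchanged in [u (sphinv l x)]. Hence the difference is the
    integral of [K] (f - F) over the ball, stated with sums to avoid subtracting integrals; the
    finiteness permits the later cancellation. *)
Lemma sphere_identity :
  ((u x)%:E + \int[mu]_y (K y * F y * chib y)%:E =
   (u (sphinv l x))%:E + \int[mu]_y (K y * f y * chib y)%:E)%E /\
  (\int[mu]_y (K y * F y * chib y)%:E \is a fin_num)%E.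
Proof.
have X0 : (0 <= \int[mu]_y (K y * F y * chib y)%:E)%E.
  by apply: integral_ge0 => y _; rewrite lee_fin; exact: KF_ge0.
have s0 : (0 <= \int[mu]_y (gker C x y * f y * chis y)%:E)%E.
  by apply: integral_ge0 => y _; rewrite lee_fin; exact: gfs_ge0.
have a0 : (0 <= \int[mu]_y (gker C x (sphinv l y) * f y * chib y)%:E)%E.
  by apply: integral_ge0 => y _; rewrite lee_fin; exact: gIfb_ge0.
have b0 : (0 <= \int[mu]_y (gker C x (sphinv l y) * F y * chib y)%:E)%E.
  by apply: integral_ge0 => y _; rewrite lee_fin; exact: gIFb_ge0.
have := decomp hIx; rewrite swap_in swap_on swap_out.
have := decomp hx; rewrite split_in.
by move=> E1 E2; exact: (ereal_exchange E1 E2 a0 s0 b0 X0).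
Qed.

End point.
End sphere.
End scaling_spheres.

(** * Comparison of [u] with its inverted copy *)

Section comparison.
Context {R : realType}.
Variable n : nat.
Implicit Types x y z : 'rV[R]_n.+1.
Let H := @half_space R n.
Let mu := @lebesgue_rV R n.+1.
Variables (C p a : R) (u : 'rV[R]_n.+1 -> R).
Hypothesis C0 : 0 < C.
Hypothesis p_ge1 : 1 <= p.
Hypothesis a_gt : - n.+1%:R < a.
Hypothesis u_ge0 : forall x, H x -> 0 <= u x.
Let f := source p a u.
Hypothesis mf : measurable_fun setT f.
Hypothesis uE : forall x, H x -> ((u x)%:E = \int[mu]_y (gker C x y * f y)%:E)%E.

Let p0 : 0 < p. Proof. exact: lt_le_trans p_ge1. Qed.

(* A globally measurable function which coincides with u on the half space. *)
Let uH y : R := (f y * sqn y `^ (- (a / 2))) `^ p^-1.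

Let uHE y : H y -> uH y = u y.
Proof.
move=> hy; have y0 : 0 < sqn y by rewrite sqn_gt0; exact: half_space_neq0.
rewrite /uH /f /source ifT// mulrAC -powRD; last by apply/implyP => _; rewrite gt_eqF.
rewrite subrr powRr0 mul1r -powRrM mulfV ?gt_eqF// powRr1//.
exact: u_ge0.
Qed.

Let measurable_uH : measurable_fun setT uH.
Proof.
apply: (measurableT_comp (measurable_powR p^-1)); apply: measurable_funM => //.
apply: (measurableT_comp (measurable_powR _)); exact: measurable_fun_sqn.
Qed.

(** With r = l^2/|y|^2 the image of [y] has norm r |y|, so Jacobian and weight combine into
    r^(n+1+a). By [a_gt] this is greater than 1 inside the ball. *)
Let J_pow (l : R) y : 0 < l -> y != 0 ->
  (l ^+ 2 / sqn y) ^+ n.+1 * sqn (sphinv l y) `^ (a / 2) =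
  (l ^+ 2 / sqn y) `^ (n.+1%:R + a) * sqn y `^ (a / 2).
Proof.
move=> l0 y0; rewrite sqn_sphinv//; have q0 : 0 < sqn y by rewrite sqn_gt0.
set r := l ^+ 2 / sqn y; have r0 : 0 < r by rewrite divr_gt0 ?exprn_gt0.
have -> : l ^+ 4 / sqn y = r ^+ 2 * sqn y by rewrite /r; field; rewrite gt_eqF.
rewrite powRM ?sqr_ge0 ?(ltW q0)// mulrA; congr (_ * _).
rewrite powRD; last by apply/implyP => _; rewrite gt_eqF.
rewrite powR_mulrn ?(ltW r0)//; congr (_ * _).
by rewrite -powR_mulrn ?(ltW r0)// -powRrM; congr (_ `^ _); field.
Qed.

Lemma reflected_source_ge (l : R) y : 0 < l -> H y -> sqn y < l ^+ 2 ->
  sqn y `^ (a / 2) * u (sphinv l y) `^ p <= reflected_source p a u l y.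
Proof.
move=> l0 hy yl; have y0 := half_space_neq0 hy.
have q0 : 0 < sqn y by rewrite sqn_gt0.
rewrite /reflected_source /source ifT; last exact: height_sphinv_gt0.
rewrite mulrA J_pow// -mulrA ler_peMl ?mulr_ge0 ?powR_ge0//.
have r1 : 1 <= l ^+ 2 / sqn y by rewrite ler_pdivlMr// mul1r ltW.
have na : 0 <= n.+1%:R + a by move: a_gt; lra.
by rewrite -[leLHS](powRr0 (l ^+ 2 / sqn y)) ler_powR.
Qed.

Lemma reflected_source_gt (l : R) y : 0 < l -> H y -> sqn y < l ^+ 2 ->
  0 < u (sphinv l y) ->
  sqn y `^ (a / 2) * u (sphinv l y) `^ p < reflected_source p a u l y.
Proof.
move=> l0 hy yl uy; have y0 := half_space_neq0 hy.
have q0 : 0 < sqn y by rewrite sqn_gt0.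
rewrite /reflected_source /source ifT; last exact: height_sphinv_gt0.
rewrite mulrA J_pow// -mulrA ltr_pMl ?mulr_gt0 ?powR_gt0//.
have r1 : 1 < l ^+ 2 / sqn y by rewrite ltr_pdivlMr// mul1r.
have na : 0 < n.+1%:R + a by move: a_gt; lra.
have : (1 : R) `^ (n.+1%:R + a) < (l ^+ 2 / sqn y) `^ (n.+1%:R + a).
  by rewrite gt0_ltr_powR ?nnegrE// ltW// (lt_trans ltr01).
by rewrite powR1.
Qed.

Definition bad_set (l : R) : set 'rV[R]_n.+1 :=
  [set y | [/\ 0 < height y, sqn y < l ^+ 2 & u (sphinv l y) < u y]].

Lemma measurable_bad_set (l : R) : 0 < l -> measurable (bad_set l).
Proof.
move=> l0.
pose b y := [&& 0 < height y, sqn y < l ^+ 2 & uH (sphinv l y) < uH y].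
have -> : bad_set l = [set: 'rV[R]_n.+1] `&` b @^-1` [set true].
  rewrite setTI; apply/seteqP; split => y /=.
    by move=> [h1 h2 h3]; rewrite /b h1 h2 !uHE//; exact: height_sphinv_gt0.
  move=> /and3P[h1 h2]; rewrite !uHE//; exact: height_sphinv_gt0.
have : measurable_fun setT b; last by apply.
apply: measurable_and; first by apply: measurable_fun_ltr => //; exact: measurable_height.
apply: measurable_and.
  by apply: measurable_fun_ltr => //; exact: measurable_fun_sqn.
exact: (measurable_fun_ltr (measurableT_comp measurable_uH (@measurable_sphinv _ _ l))
  measurable_uH).
Qed.

Section sphere.
Variable l : R.
Hypothesis l0 : 0 < l.
Variable x : 'rV[R]_n.+1.
Hypothesis hx : H x.
Hypothesis xl : sqn x < l ^+ 2.
Let chib y : R := ((sqn y < l ^+ 2) && (y != x))%R%:R.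
Let K := sphere_kernel C l x.
Let F := reflected_source p a u l.

Let mK : measurable_fun setT K.
Proof.
apply: measurable_funB; first exact: measurable_gker.
exact: measurableT_comp (measurable_gker C x) (@measurable_sphinv _ _ l).
Qed.

Let mF : measurable_fun setT F.
Proof.
apply: measurable_funM; last exact: measurableT_comp mf (@measurable_sphinv _ _ l).
apply: measurable_funX; apply: measurable_funM => //.
apply: measurable_fun_inv; exact: measurable_fun_sqn.
Qed.

Let mchib : measurable_fun setT chib.
Proof.
apply: measurable_fun_natr; apply: measurable_and.
  by apply: measurable_fun_ltr => //; exact: measurable_fun_sqn.
have -> : (fun y => y != x) = (fun y => 0 < sqn (x - y)).
  by apply/funext => y; rewrite sqn_gt0 subr_eq0 eq_sym.
apply: measurable_fun_ltr => //.
by apply: measurable_fun_sqn; apply: measurable_rVB.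
Qed.

Let K_gt0 y : H y -> sqn y < l ^+ 2 -> y != x -> 0 < K y.
Proof.
move=> hy yl yx; rewrite subr_gt0; apply: gker_sphinv_lt => //.
by rewrite eq_sym.
Qed.

Let f_out y : ~~ (0 < height y) -> f y = 0.
Proof. by rewrite /f /source => /negPf ->. Qed.

Let F_out y : ~~ (0 < height y) -> F y = 0.
Proof.
move=> hy; rewrite /F /reflected_source /source ifF ?mulr0//.
exact/negbTE/height_sphinv_le0.
Qed.

Let fE y : H y -> f y = sqn y `^ (a / 2) * u y `^ p.
Proof. by move=> hy; rewrite /f /source ifT. Qed.

Let F_ge0 y : 0 <= F y.
Proof. by rewrite mulr_ge0 ?source_ge0// exprn_ge0// divr_ge0 ?sqr_ge0 ?sqn_ge0. Qed.

(** Outside the bad set f <= F, so only the bad set can make [u x] exceed [u (sphinv l x)]. There f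
    - F is at most T |y|^a, and [K] is at most the kernel itself. *)
Lemma sphere_comparison (T : R) : 0 <= T ->
  (forall y, bad_set l y -> u y `^ p - u (sphinv l y) `^ p <= T) ->
  ((u x)%:E <= (u (sphinv l x))%:E +
     \int[mu]_(y in bad_set l) (T * (gker C x y * sqn y `^ (a / 2)))%:E)%E.
Proof.
move=> T0 hT.
have [] := sphere_identity C0 mf uE l0 hx xl.
rewrite -/K -/F -/f => E Xfin.
apply: (ereal_cancel_le Xfin E).
have mG : measurable_fun setT (fun y => T * (gker C x y * sqn y `^ (a / 2))).
  apply: measurable_funM => //; apply: measurable_funM; first exact: measurable_gker.
  apply: (measurableT_comp (measurable_powR _)); exact: measurable_fun_sqn.
have mA := measurable_bad_set l0.
have G0 y : bad_set l y -> 0 <= T * (gker C x y * sqn y `^ (a / 2)).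
  by move=> [hy _ _]; rewrite mulr_ge0// mulr_ge0 ?powR_ge0// gker_ge0 ?ltW.
rewrite [X in (_ <= X + _)%E]integral_mkcond.
rewrite -ge0_integralD//; last 4 first.
- by move=> y _; apply: erestrict_ge0 => z hz; rewrite lee_fin G0.
- apply/(measurable_restrictT _ mA); apply: measurable_funTS; exact/measurable_EFinP.
- move=> y _; rewrite lee_fin.
  have [hy|hy] := boolP (0 < height y); last by rewrite F_out// mulr0 mul0r.
  case: (boolP (_ && _)) => [/andP[yl yx]|_]; last by rewrite mulr0.
  by rewrite mulr1 mulr_ge0 ?F_ge0// ltW// K_gt0.
- by apply/measurable_EFinP; exact: (measurable_funM (measurable_funM mK mF) mchib).
apply: ge0_le_integral => //.
- move=> y _; rewrite lee_fin.
  have [hy|hy] := boolP (0 < height y); last by rewrite f_out// mulr0 mul0r.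
  case: (boolP (_ && _)) => [/andP[yl yx]|_]; last by rewrite mulr0.
  by rewrite mulr1 mulr_ge0 ?source_ge0// ltW// K_gt0.
- by apply/measurable_EFinP; exact: (measurable_funM (measurable_funM mK mf) mchib).
- apply: emeasurable_funD.
    by apply/(measurable_restrictT _ mA); apply: measurable_funTS; exact/measurable_EFinP.
  by apply/measurable_EFinP; exact: (measurable_funM (measurable_funM mK mF) mchib).
move=> y _.
have R0 : (0 <= ((fun y => (T * (gker C x y * sqn y `^ (a / 2)))%:E) \_ (bad_set l)) y)%E.
  by apply: erestrict_ge0 => z hz; rewrite lee_fin G0.
have [hy|hy] := boolP (0 < height y); last first.
  by rewrite f_out// F_out// mulr0 mul0r adde0.
case: (boolP (_ && _)) => [/andP[yl yx]|_]; last by rewrite !mulr0 adde0.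
rewrite !mulr1.
have w0 : 0 <= sqn y `^ (a / 2) by exact: powR_ge0.
have Fy := reflected_source_ge l0 hy yl.
have Ky := ltW (K_gt0 hy yl yx).
have KG : K y <= gker C x y.
  by rewrite gerBl gker_ge0 ?(ltW C0)// ltW// height_sphinv_gt0.
have [yA|yA] := pselect (bad_set l y).
  rewrite /patch mem_set// -EFinD lee_fin fE//.
  apply: (@le_trans _ _ (K y * (sqn y `^ (a / 2) * (u (sphinv l y) `^ p + T)))).
    by rewrite ler_wpM2l// ler_wpM2l//; have := hT _ yA; lra.
  rewrite mulrDr mulrDr addrC lerD//; last by rewrite ler_wpM2l.
  by rewrite mulrA [_ * T]mulrC ler_wpM2l// ler_wpM2r.
apply: (@le_trans _ _ (K y * F y)%:E); last by rewrite leeDr.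
rewrite lee_fin ler_wpM2l// fE//; apply: le_trans Fy; rewrite ler_wpM2l//.
apply: ge0_ler_powR.
- exact: ltW.
- by rewrite nnegrE; exact: u_ge0.
- by rewrite nnegrE; apply: u_ge0; exact: height_sphinv_gt0.
by rewrite leNgt; apply/negP => hlt; apply: yA.
Qed.

(** Strictness comes from the factor r^(n+1+a) > 1: even where [u] equals its copy, f < F because
    [u] is positive. So [D] is positive on the half ball without [x], which is not null. *)
Lemma sphere_comparison_lt :
  (forall y, H y -> 0 < u y) ->
  (forall y, H y -> sqn y < l ^+ 2 -> u y <= u (sphinv l y)) ->
  u x < u (sphinv l x).
Proof.
move=> upos hle.
have [] := sphere_identity C0 mf uE l0 hx xl.
rewrite -/K -/F -/f => E Xfin.
pose D y := K y * (F y - f y) * chib y.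
have Fgt y : H y -> sqn y < l ^+ 2 -> f y < F y.
  move=> hy yl; apply: le_lt_trans (reflected_source_gt l0 hy yl _); last first.
    by apply: upos; exact: height_sphinv_gt0.
  rewrite fE//; apply: ler_wpM2l; first exact: powR_ge0.
  apply: ge0_ler_powR.
  - exact: ltW.
  - by rewrite nnegrE; exact: u_ge0.
  - by rewrite nnegrE; apply: u_ge0; exact: height_sphinv_gt0.
  - exact: hle.
have D0 y : 0 <= D y.
  rewrite /D; have [hy|hy] := boolP (0 < height y); last first.
    by rewrite F_out// f_out// subrr mulr0 mul0r.
  rewrite /chib; case: (boolP (_ && _)) => [/andP[yl yx]|_]; last by rewrite mulr0.
  by rewrite mulr1 mulr_ge0 ?(ltW (K_gt0 hy yl yx))// subr_ge0 ltW// Fgt.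
have mD : measurable_fun setT D.
  exact: (measurable_funM (measurable_funM mK (measurable_funB mF mf)) mchib).
have f0 y : 0 <= K y * f y * chib y.
  have [hy|hy] := boolP (0 < height y); last by rewrite f_out// mulr0 mul0r.
  rewrite /chib; case: (boolP (_ && _)) => [/andP[yl yx]|_]; last by rewrite mulr0.
  by rewrite mulr1 mulr_ge0 ?source_ge0// ltW// K_gt0.
have mfc : measurable_fun setT (fun y => K y * f y * chib y).
  exact: (measurable_funM (measurable_funM mK mf) mchib).
have XE : (\int[mu]_y (K y * F y * chib y)%:E =
    \int[mu]_y (K y * f y * chib y)%:E + \int[mu]_y (D y)%:E)%E.
  rewrite -ge0_integralD//; last 4 first.
  - by move=> y _; rewrite lee_fin.
  - exact/measurable_EFinP.
  - by move=> y _; rewrite lee_fin.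
  - exact/measurable_EFinP.
  by apply: eq_integral => y _; rewrite -EFinD /D; congr EFin; ring.
pose A := H `&` @eball R n l.
have oA : open A by apply: openI; [exact: open_half_space|exact: open_eball].
have mA : measurable A.
  by apply: measurableI; [exact: measurable_half_space|exact: measurable_eball].
have muA : mu (A `\` [set x]) != 0%E.
  by apply: measure_setD_point => //; apply: (open_measure_neq0 oA (x := x)).
have I0 : (0 < \int[mu]_y (D y)%:E)%E.
  apply: (integral_gt0 mD D0 _ muA); first by apply: measurableD => //; exact: measurable_point.
  move=> y [[hy yl] /eqP yx]; rewrite /D /chib yl yx mulr1 mulr_gt0 ?K_gt0//.
  by rewrite subr_gt0 Fgt.
move: E Xfin; rewrite XE => E Xfin.
exact: (ereal_cancel_lt Xfin E I0).
Qed.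

End sphere.

(** A strong maximum principle: positivity at one point spreads to a neighbourhood by continuity,
    and then everywhere through the positive kernel. *)
Lemma positive_half_space y0 : H y0 -> 0 < u y0 ->
  (forall x, H x -> u y @[y --> x] --> u x) -> forall x, H x -> 0 < u x.
Proof.
move=> hy0 uy0 ucont x hx; rewrite -lte_fin uE//.
have mg : measurable_fun setT (fun y => gker C x y * f y).
  exact: (measurable_funM (measurable_gker C x) mf).
have g0 y : 0 <= gker C x y * f y by exact: gker_source_ge0.
pose A := [set y | (0 < height y) && (0 < uH y)].
have mA : measurable A.
  have -> : A = [set: 'rV[R]_n.+1] `&` (fun y => (0 < height y) && (0 < uH y)) @^-1` [set true].
    by rewrite setTI.
  have : measurable_fun setT (fun y => (0 < height y) && (0 < uH y)); last by apply.
  apply: measurable_and.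
    exact: (measurable_fun_ltr (measurable_cst _) (@measurable_height R n)).
  exact: (measurable_fun_ltr (measurable_cst _) measurable_uH).
have nA : nbhs y0 A.
  have := ucont _ hy0 => /cvgr_gt /(_ _ uy0) n1.
  have n2 : nbhs y0 H by apply: open_nbhs_nbhs; split=> //; exact: open_half_space.
  by apply: filterS2 n1 n2 => y /= h1 h2; rewrite /A /= uHE// h1 andbT.
have muA : mu (A `\` [set x]) != 0%E.
  apply: measure_setD_point => //.
  apply: (@open_measure_neq0 _ _ A y0 (interior A)) => //.
  - exact: open_interior.
  - exact: interior_subset.
apply: (integral_gt0 mg g0 _ muA); first by apply: measurableD => //; exact: measurable_point.
move=> y [/andP[hy uy] /eqP yx]; rewrite mulr_gt0 ?gker_gt0//; first by rewrite eq_sym.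
rewrite /f /source hy mulr_gt0 ?powR_gt0//; last by rewrite -uHE.
by rewrite sqn_gt0; exact: half_space_neq0.
Qed.

End comparison.

(** A product of singularities at [x] and at 0 is at most the sum of two single ones of the combined
    exponent: replace the larger of |x - y| and |y| by the smaller. Writing [0 - y] presents the
    second as a singular integrand with pole 0. *)
Lemma weight_le (R : realType) n (C a e al lam : R) (x y : 'rV[R]_n.+1) :
  0 <= C -> 0 < e -> 0 <= al -> 0 <= a + al ->
  0 < height x -> 0 < height y -> sqn x <= lam ^+ 2 -> sqn y <= lam ^+ 2 ->
  gker C x y * sqn y `^ (a / 2) <=
  C / (2 * e) * (8 * lam ^+ 2) `^ e * (lam ^+ 2) `^ ((a + al) / 2) *
   (sqn (x - y) `^ (- (e + al / 2)) + sqn (0 - y) `^ (- (e + al / 2))).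
Proof.
move=> C0 e0 al0 aal hx hy xl yl.
have -> : sqn (0 - y) = sqn y by rewrite sqnB -[sqn 0]/(dot 0 0) -(scale0r y) !dotZl; ring.
have y0 : 0 < sqn y by rewrite sqn_gt0; exact: half_space_neq0.
have g1 := gker_le_powR C0 e0 hx hy xl yl.
have w1 : sqn y `^ (a / 2) <= (lam ^+ 2) `^ ((a + al) / 2) * sqn y `^ (- (al / 2)).
  have -> : a / 2 = (a + al) / 2 + (- (al / 2)) by field.
  rewrite powRD; last by apply/implyP => _; rewrite gt_eqF.
  rewrite ler_wpM2r ?powR_ge0// ge0_ler_powR ?nnegrE ?sqr_ge0 ?(ltW y0)//.
  by rewrite divr_ge0.
have q0 : 0 <= sqn (x - y) by exact: sqn_ge0.
set q := sqn (x - y) in g1 q0 *.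
have key : q `^ (- e) * sqn y `^ (- (al / 2)) <=
    q `^ (- (e + al / 2)) + sqn y `^ (- (e + al / 2)).
  have [->|qn0] := eqVneq q 0.
    rewrite powR0 ?oppr_eq0 ?gt_eqF// mul0r addr_ge0 ?powR_ge0//.
  have qp : 0 < q by rewrite lt_def qn0.
  rewrite opprD powRD; last by apply/implyP => _; rewrite gt_eqF.
  rewrite powRD; last by apply/implyP => _; rewrite gt_eqF.
  have al2 : 0 <= al / 2 by rewrite divr_ge0.
  have [qy|qy] := leP q (sqn y).
    apply: (@le_trans _ _ (q `^ (- e) * q `^ (- (al / 2)))).
      by rewrite ler_wpM2l ?powR_ge0// powR_le_neg.
    by rewrite lerDl mulr_ge0 ?powR_ge0.
  apply: (@le_trans _ _ (sqn y `^ (- e) * sqn y `^ (- (al / 2)))).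
    by rewrite ler_wpM2r ?powR_ge0// powR_le_neg// ltW.
  by rewrite lerDr mulr_ge0 ?powR_ge0.
have c0 : 0 <= C / (2 * e) * (8 * lam ^+ 2) `^ e.
  by apply: mulr_ge0; [apply: divr_ge0 => //; lra|exact: powR_ge0].
apply: (@le_trans _ _ (C / (2 * e) * (8 * lam ^+ 2) `^ e * q `^ (- e) *
    ((lam ^+ 2) `^ ((a + al) / 2) * sqn y `^ (- (al / 2))))).
  apply: ler_pM => //; last exact: powR_ge0.
  by apply: gker_ge0 => //; exact: ltW.
set c := C / (2 * e) * _ in c0 *.
have -> : c * q `^ (- e) * ((lam ^+ 2) `^ ((a + al) / 2) * sqn y `^ (- (al / 2))) =
  c * (lam ^+ 2) `^ ((a + al) / 2) * (q `^ (- e) * sqn y `^ (- (al / 2))) by ring.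
by apply: ler_wpM2l => //; apply: mulr_ge0 => //; exact: powR_ge0.
Qed.

(** * Monotonicity with respect to all spheres *)

Section spheres.
Context {R : realType}.
Variable n : nat.
Implicit Types x y z : 'rV[R]_n.+1.
Let H := @half_space R n.
Let mu := @lebesgue_rV R n.+1.
Variables (C p a : R) (u : 'rV[R]_n.+1 -> R).
Hypothesis C0 : 0 < C.
Hypothesis p_ge1 : 1 <= p.
Hypothesis a_gt : - n.+1%:R < a.
Hypothesis u_ge0 : forall x, H x -> 0 <= u x.
Let f := source p a u.
Hypothesis mf : measurable_fun setT f.
Hypothesis uE : forall x, H x -> ((u x)%:E = \int[mu]_y (gker C x y * f y)%:E)%E.
Hypothesis u_cont : forall x, H x -> u y @[y --> x] --> u x.
Hypothesis u_bounded : forall r : R, exists2 M, 0 < M &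
  forall y, H y -> sqn y <= r ^+ 2 -> u y <= M.

Definition sphere_monotone (l : R) : Prop :=
  forall x, H x -> sqn x < l ^+ 2 -> u x <= u (sphinv l x).

(** A contraction: if u(y) - u(y') <= S on the bad set, y' being the image of y, the same holds with
    S/2 on the whole half ball. Iteration starts from the bound M of [u] for |y| <= lam and drives
    the excess to 0. Only [lam] enters the choice of [delta], so it serves all radii up to [lam]. *)
Lemma small_bad_set (lam : R) : 0 < lam -> exists2 delta, 0 < delta &
  forall l, 0 < l -> l <= lam -> (mu (bad_set u l) <= delta%:E)%E -> sphere_monotone l.
Proof.
move=> lam0; have [M M0 hM] := u_bounded lam.
pose k := Num.bound p.
have pk : p <= k%:R by apply/ltW/archi_boundP; exact: le_trans p_ge1.
have k0 : 0 < k%:R :> R by apply: lt_le_trans pk; exact: lt_le_trans p_ge1.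
pose L := k%:R * M `^ (p - 1).
have L0 : 0 < L by rewrite mulr_gt0// powR_gt0.
(* With 2b = (n + 1 + al) / 2 < n + 1, both singularities |x - y|^(-2e) of the
   kernel and |y|^(-al) of the weight are absorbed into power -2b. *)
pose al := Num.max 0 (- a).
have al0 : 0 <= al by rewrite le_max lexx.
have aal : 0 <= a + al by rewrite -lerBlDl sub0r le_max lexx orbT.
have aln : al < n.+1%:R by rewrite gt_max ltr0n /= ltrNl.
pose e : R := (n.+1%:R - al) / 4.
have e0 : 0 < e by rewrite divr_gt0// subr_gt0.
pose b := e + al / 2.
have b0 : 0 < b by rewrite ltr_wpDr// divr_ge0.
have bn : 2 * b < n.+1%:R.
  have -> : 2 * b = (n.+1%:R + al) / 2 by rewrite /b /e; field.
  by rewrite ltr_pdivrMr//; lra.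
pose c1 := C / (2 * e) * (8 * lam ^+ 2) `^ e * (lam ^+ 2) `^ ((a + al) / 2).
have c10 : 0 < c1.
  rewrite mulr_gt0 ?powR_gt0 ?exprn_gt0// mulr_gt0 ?powR_gt0//.
    by rewrite divr_gt0// mulr_gt0.
  by rewrite mulr_gt0// exprn_gt0.
(* The singular integrals with poles [x] and 0 are each at most eta, and L S c1 (eta + eta) = S /
   2. *)
pose eta := (4 * L * c1)^-1.
have Lc0 : 0 < 4 * L * c1 by apply: mulr_gt0 => //; apply: mulr_gt0.
have eta0 : 0 < eta by rewrite invr_gt0.
have [delta d0 hd] := singular_integral_small b0 bn eta0.
exists delta => // l l0 ll mA.
have l2 : l ^+ 2 <= lam ^+ 2 by rewrite ler_sqr ?nnegrE ?(ltW l0) ?(ltW lam0).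
have msA := measurable_bad_set p_ge1 u_ge0 mf l0.
have Hinv y : H y -> H (sphinv l y) by move=> hy; exact: height_sphinv_gt0.
have mw x : measurable_fun setT (fun y : 'rV[R]_n.+1 => sqn (x - y) `^ (- b)).
  apply: (measurableT_comp (measurable_powR (- b))).
  by apply: measurable_fun_sqn; apply: measurable_rVB.
have step S : 0 <= S -> (forall y, bad_set u l y -> u y - u (sphinv l y) <= S) ->
    forall x, H x -> sqn x < l ^+ 2 -> u x - u (sphinv l x) <= S / 2.
  move=> S0 hS x hx xl.
  have T0 : 0 <= L * S by rewrite mulr_ge0// ltW.
  have hT y : bad_set u l y -> u y `^ p - u (sphinv l y) `^ p <= L * S.
    move=> hy; have [y1 y2 y3] := hy.
    apply: (@le_trans _ _ (L * (u y - u (sphinv l y)))).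
      apply: powR_lipschitz => //; [exact/u_ge0/Hinv|exact: ltW|].
      by apply: hM => //; apply: le_trans l2; exact: ltW.
    by rewrite ler_wpM2l ?(ltW L0)// hS.
  have := sphere_comparison C0 p_ge1 a_gt u_ge0 mf uE l0 hx xl T0 hT.
  rewrite lerBlDl -lee_fin EFinD; move/le_trans; apply; apply: leeD2l.
  apply: (@le_trans _ _ (\int[mu]_(y in bad_set u l)
      ((L * S * c1)%:E * ((sqn (x - y) `^ (- b))%:E + (sqn (0 - y) `^ (- b))%:E)))%E).
    apply: ge0_le_integral.
    - exact: msA.
    - move=> y [hy _ _]; rewrite lee_fin mulr_ge0// mulr_ge0 ?powR_ge0//.
      by apply: gker_ge0; exact: ltW.
    - apply: measurable_funTS; apply/measurable_EFinP; apply: measurable_funM => //.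
      apply: measurable_funM; first exact: measurable_gker.
      apply: (measurableT_comp (measurable_powR _)); exact: measurable_fun_sqn.
    - apply: measurable_funTS; apply: emeasurable_funM => //.
      by apply: emeasurable_funD; apply/measurable_EFinP; exact: mw.
    - move=> y [hy yl _]; rewrite -EFinD -EFinM lee_fin -[leRHS]mulrA ler_wpM2l//.
      apply: weight_le => //; [exact: ltW| |].
      + by apply: le_trans l2; exact: ltW.
      + by apply: le_trans l2; exact: ltW.
  rewrite ge0_integralZl//=; last 3 first.
  - by apply: measurable_funTS; apply: emeasurable_funD; apply/measurable_EFinP; exact: mw.
  - by move=> y _; rewrite -EFinD lee_fin addr_ge0 ?powR_ge0.
  - by rewrite lee_fin mulr_ge0// ltW.
  rewrite ge0_integralD//=; last 4 first.
  - by move=> y _; rewrite lee_fin powR_ge0.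
  - by apply: measurable_funTS; apply/measurable_EFinP; exact: mw.
  - by move=> y _; rewrite lee_fin powR_ge0.
  - by apply: measurable_funTS; apply/measurable_EFinP; exact: mw.
  apply: (@le_trans _ _ ((L * S * c1)%:E * (eta%:E + eta%:E))%E).
    by apply: lee_wpmul2l; [rewrite lee_fin mulr_ge0// ltW|apply: leeD; exact: hd].
  rewrite -EFinD -EFinM lee_fin /eta.
  by rewrite le_eqVlt; apply/orP; left; apply/eqP; field; rewrite !gt_eqF.
have iter j : forall x, H x -> sqn x < l ^+ 2 -> u x - u (sphinv l x) <= M / 2 ^+ j.
  elim: j => [|j IH] x hx xl.
    have uxM : u x <= M by apply: hM => //; apply: le_trans l2; exact: ltW.
    have := u_ge0 (Hinv x hx); rewrite expr0 divr1; lra.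
  rewrite exprSr invfM mulrA; apply: step => //.
  - by rewrite divr_ge0 ?exprn_ge0 ?ltW.
  - by move=> y [hy yl _]; exact: IH.
move=> x hx xl; rewrite -subr_le0 leNgt; apply/negP => D0.
set D := u x - _ in D0.
have [j hj] := pow2_ge_nat (M / D + 1).
have := iter j x hx xl; rewrite -/D ler_pdivlMr ?exprn_gt0// mulrC -ler_pdivlMr//.
by lra.
Qed.

(** [l0] is the infimum of the failing radii. It is positive, the comparison holds at [l0] and is
    strict inside, and the failing radii decreasing to [l0] lead to a contradiction in measure. *)
Lemma sphere_monotoneT : (forall x, H x -> 0 < u x) -> forall l, 0 < l -> sphere_monotone l.
Proof.
move=> upos l1 l10; apply: contrapT => bad1.
have contl x (l : R) : H x -> 0 < l -> u (sphinv t x) @[t --> l] --> u (sphinv l x).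
  move=> hx l0; have hI : H (sphinv l x) by exact: height_sphinv_gt0.
  apply: (@cvg_comp _ _ _ (fun t => sphinv t x) u _ (nbhs (sphinv l x))); last exact: u_cont.
  have -> : (fun t => sphinv t x) = (fun t => (t ^+ 2 / sqn x) *: x) by [].
  apply: cvgZr_tmp; apply: cvgMr_tmp; exact: exprn_continuous.
pose B : set R := [set l | 0 < l /\ ~ sphere_monotone l].
have B1 : B l1 by [].
have lbB : has_lbound B by exists 0 => l [/ltW].
have infB : has_inf B by split; [exists l1|].
pose l0 := inf B.
have good_lt l : 0 < l -> l < l0 -> sphere_monotone l.
  move=> l0' ll; apply: contrapT => nl.
  by have := ge_inf lbB (conj l0' nl : B l); rewrite leNgt ll.
have l0_gt0 : 0 < l0.
  have [delta d0 hd] := small_bad_set ltr01.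
  (* For l < m the ball has measure at most (2l)^(n+1) <= 2l <= delta, using 2l <= 1; the entry 1 is
     the bound on radii for which [delta] was chosen. *)
  pose m := Num.min 1 (Num.min (delta / 2) 2^-1).
  have m0 : 0 < m by rewrite !lt_min ltr01 divr_gt0//= invr_gt0.
  apply: (lt_le_trans m0); apply: lb_le_inf; first by exists l1.
  move=> l [lp nl]; rewrite leNgt; apply/negP => lm; apply: nl.
  have lm1 : l <= 1 by apply: ltW; apply: lt_le_trans lm _; rewrite ge_min lexx.
  have lm2 : 2 * l <= delta.
    rewrite mulrC -ler_pdivlMr//; apply: ltW; apply: lt_le_trans lm _.
    by rewrite !ge_min lexx orbT.
  have lm3 : 2 * l <= 1.
    rewrite mulrC -ler_pdivlMr// mul1r; apply: ltW; apply: lt_le_trans lm _.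
    by rewrite !ge_min lexx !orbT.
  apply: hd => //; apply: (@le_trans _ _ (mu (@eball R n l))).
    apply: le_measure; rewrite ?inE; [|exact: measurable_eball|by move=> y []].
    exact: (measurable_bad_set p_ge1 u_ge0 mf).
  apply: (le_trans (lebesgue_rV_eball_le _ (ltW lp))); rewrite lee_fin exprS.
  apply: le_trans lm2; rewrite ler_piMr ?mulr_ge0 ?(ltW lp)//.
  by rewrite exprn_ile1// mulr_ge0// ltW.
(* A failure at a point x persists, by continuity in the radius, for some radius below [l0]. *)
have good0 : sphere_monotone l0.
  move=> x hx xl; rewrite leNgt; apply/negP => hlt.
  have /cvgr_lt /(_ _ hlt) n1 := contl x l0 hx l0_gt0.
  have : \forall t \near l0, sqn x < t ^+ 2.
    have /cvgr_gt /(_ _ xl) := @exprn_continuous R 2 l0; exact.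
  move=> n2; have n3 : \forall t \near l0, 0 < t by exact: lt_nbhsr.
  have /nbhs_ballP [d d0 hd] :
      nbhs l0 [set t | [/\ u (sphinv t x) < u x, sqn x < t ^+ 2 & 0 < t]].
    by near=> t; split; near: t.
  have [h1 h2 h3] : [set t | [/\ u (sphinv t x) < u x, sqn x < t ^+ 2 & 0 < t]] (l0 - d / 2).
    by apply: hd; rewrite /ball /= opprB addrC subrK gtr0_norm ?divr_gt0//;
      rewrite ltr_pdivrMr//; move: d0 => /=; lra.
  have := good_lt _ h3 _ x hx h2; rewrite leNgt h1 => /(_ _)/negP; apply => //.
  by rewrite ltrBlDr ltrDl divr_gt0.
have strict0 x : H x -> sqn x < l0 ^+ 2 -> u x < u (sphinv l0 x).
  by move=> hx xl; exact: (sphere_comparison_lt C0 p_ge1 a_gt u_ge0 mf uE).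
(* The bound [l0 + 1] covers all the failing radii [L k], so one [delta] serves the whole
   sequence. *)
have [delta d0 hd] := small_bad_set (addr_gt0 l0_gt0 ltr01).
have exl k : exists l, [/\ l0 <= l, l < l0 + k.+1%:R^-1 & ~ sphere_monotone l].
  have kp : 0 < k.+1%:R^-1 :> R by rewrite invr_gt0 ltr0n.
  have [l [lp nl] ll] := inf_adherent kp infB.
  by exists l; split=> //; apply: ge_inf.
have [L hL] := choice exl.
have Lpos k : 0 < L k by have [h _ _] := hL k; exact: lt_le_trans h.
have Lle k : L k <= l0 + 1.
  have [_ h _] := hL k; apply: (le_trans (ltW h)); rewrite lerD2l.
  by rewrite invf_le1 ?ltr0n// ler1n.
have Lcvg (P : R -> Prop) : (\forall t \near l0, P t) ->
    exists m, forall k, (m <= k)%N -> P (L k).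
  move=> /nbhs_ballP [d dp hdP].
  exists (Num.bound d^-1) => k mk; apply: hdP; rewrite /ball /= distrC.
  have [h1 h2 _] := hL k.
  rewrite ger0_norm ?subr_ge0// ltrBlDl (lt_le_trans h2)// lerD2l.
  rewrite -[d]invrK lef_pV2 ?posrE ?ltr0n ?invr_gt0//.
  apply: (le_trans (ltW (archi_boundP _))); first by rewrite invr_ge0 ltW.
  by rewrite ler_nat (leq_trans mk).
pose A k := bad_set u (L k).
have mA k : measurable (A k) by exact: (measurable_bad_set p_ge1 u_ge0 mf).
have bigA k : (delta%:E < mu (A k))%E.
  rewrite ltNge; apply/negP => h; have [_ _] := hL k; apply; exact: hd.
(* A point in infinitely many bad sets lies on the sphere of radius [l0]: a point farther out
   eventually leaves the balls, and farther in the strict inequality at [l0] persists for nearby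
   radii. *)
have lsA : lim_sup_set A `<=` [set y | sqn y = l0 ^+ 2].
  move=> y hy.
  have ex m : exists2 k, (m <= k)%N & A k y by have [k ? ?] := hy m Logic.I; exists k.
  have [k0 _ [yh _ _]] := ex 0%N.
  apply/eqP; rewrite eq_le !leNgt; apply/andP; split; apply/negP => hlt.
    have := @exprn_continuous R 2 l0 => /cvgr_lt /(_ _ hlt) /Lcvg [m hm].
    have [k mk [_ h _]] := ex m.
    by have := hm _ mk; rewrite ltNge (ltW h).
  have /cvgr_gt /(_ _ (strict0 y yh hlt)) /Lcvg [m hm] := contl y l0 yh l0_gt0.
  have [k mk [_ _ h]] := ex m.
  by have := hm _ mk; rewrite ltNge (ltW h).
have mls : measurable (lim_sup_set A).
  by apply: bigcap_measurable => // k _; exact: bigcup_measurable.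
have mu0 : mu (lim_sup_set A) = 0%E.
  apply/eqP; rewrite -measure_le0 -(lebesgue_rV_sphere n l0_gt0).
  apply: le_measure; rewrite ?inE//.
  have : measurable_fun setT (fun y : 'rV[R]_n.+1 => sqn y == l0 ^+ 2).
    by apply: measurable_fun_eqr => //; exact: measurable_fun_sqn.
  move=> /(_ measurableT [set true] Logic.I); rewrite setTI.
  by congr measurable; apply/seteqP; split => y /= /eqP.
(* Continuity of the measure from above needs a finite measure to start from. *)
have fin : (mu (\bigcup_(k >= 0) A k) < +oo)%E.
  have l10' : 0 <= l0 + 1 by rewrite addr_ge0// ltW.
  apply: le_lt_trans (ltry ((2 * (l0 + 1)) ^+ n.+1)).
  apply: le_trans (lebesgue_rV_eball_le n l10').
  apply: le_measure; rewrite ?inE; [exact: bigcup_measurable|exact: measurable_eball|].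
  move=> y [k _ [_ yl _]]; apply: (lt_le_trans yl).
  by rewrite ler_sqr ?nnegrE ?(ltW (Lpos k)) ?l10' ?Lle.
have cv0 : mu (\bigcup_(k >= m) A k) @[m --> \oo] --> 0%E.
  by rewrite -mu0; exact: lim_sup_set_cvg.
have : (delta%:E <= 0)%E.
  apply: (cvge_ge _ cv0); apply: nearW => m.
  apply: (le_trans (ltW (bigA m))); apply: le_measure; rewrite ?inE//.
    exact: bigcup_measurable.
  by move=> y hy; exists m => //=.
by rewrite lee_fin leNgt d0.
Unshelve. all: by end_near. Qed.

End spheres.

(** * Blow-up on a cone *)

(** The minimum covers both signs of the exponent: the lower bound on [q] serves r >= 0, the upper
    bound r < 0. *)
Lemma powR_ge_min (R : realType) (lo hi s r q : R) : 0 < lo -> 0 < s ->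
  lo * s ^+ 2 <= q -> q <= hi * s ^+ 2 ->
  Num.min (lo `^ (r / 2)) (hi `^ (r / 2)) * s `^ r <= q `^ (r / 2).
Proof.
move=> lo0 s0 h1 h2.
have s20 : 0 < s ^+ 2 by rewrite exprn_gt0.
have q0 : 0 < q by apply: lt_le_trans h1; rewrite mulr_gt0.
have hi0 : 0 < hi by rewrite -(pmulr_lgt0 _ s20); exact: lt_le_trans h2.
have -> : s `^ r = (s ^+ 2) `^ (r / 2).
  by rewrite -powR_mulrn ?(ltW s0)// -powRrM; congr (_ `^ _); field.
have [r0|r0] := leP 0 r.
  apply: (@le_trans _ _ (lo `^ (r / 2) * (s ^+ 2) `^ (r / 2))).
    by rewrite ler_wpM2r ?powR_ge0// ge_min lexx.
  rewrite -powRM ?(ltW lo0) ?(ltW s20)//; apply: ge0_ler_powR => //.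
  - by rewrite divr_ge0.
  - by rewrite nnegrE mulr_ge0 ?(ltW lo0) ?(ltW s20).
  - by rewrite nnegrE ltW.
apply: (@le_trans _ _ (hi `^ (r / 2) * (s ^+ 2) `^ (r / 2))).
  by rewrite ler_wpM2r ?powR_ge0// ge_min lexx orbT.
rewrite -powRM ?(ltW hi0) ?(ltW s20)//.
have -> : r / 2 = - (- r / 2) by ring.
by apply: powR_le_neg => //; rewrite divr_ge0// oppr_ge0 ltW.
Qed.

Section blow_up.
Context {R : realType}.
Variable n : nat.
Implicit Types x y z : 'rV[R]_n.+1.
Let H := @half_space R n.
Let mu := @lebesgue_rV R n.+1.
Variables (C p a : R) (u : 'rV[R]_n.+1 -> R).
Hypothesis C0 : 0 < C.
Hypothesis p_ge1 : 1 <= p.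
Hypothesis a_gt : - n.+1%:R < a.
Hypothesis u_gt0 : forall x, H x -> 0 < u x.
Let f := source p a u.
Hypothesis mf : measurable_fun setT f.
Hypothesis uE : forall x, H x -> ((u x)%:E = \int[mu]_y (gker C x y * f y)%:E)%E.
Hypothesis u_cont : {within closure H, continuous u}.
Hypothesis u_spheres : forall l, 0 < l -> sphere_monotone u l.

Lemma ray_monotone x (t : R) : H x -> 1 <= t -> u x <= u (t *: x).
Proof.
move=> hx t1; have [->|tn1] := eqVneq t 1; first by rewrite scale1r.
have {tn1}t1 : 1 < t by rewrite lt_def tn1.
have q0 : 0 < sqn x by rewrite sqn_gt0; exact: half_space_neq0.
have tq0 : 0 < t * sqn x by rewrite mulr_gt0// (lt_trans ltr01).
(* The inversion in the sphere of radius sqrt(t) |x| sends [x] to [t *: x]. *)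
pose l := Num.sqrt (t * sqn x).
have l2 : l ^+ 2 = t * sqn x by rewrite sqr_sqrtr// ltW.
have xl : sqn x < l ^+ 2 by rewrite l2 ltr_pMl.
have l0 : 0 < l by rewrite sqrtr_gt0.
have := u_spheres l0 hx xl.
by rewrite (_ : sphinv l x = (l ^+ 2 / sqn x) *: x)// l2 mulfK ?gt_eqF.
Qed.

Definition cone (t : R) : set 'rV[R]_n.+1 :=
  [set y | t <= height y /\ forall i, `|y 0 i| <= height y].

(** The slice of the cone at height 1 is compact and inside the open half space, so [u] has a
    positive minimum there; rays carry it upwards. *)
Lemma cone_lower_bound : exists2 m : R, 0 < m & forall y, cone 1 y -> m <= u y.
Proof.
pose K := [set z : 'rV[R]_n.+1 | height z = 1] `&`
  [set v : 'rV[R]_n.+1 | forall i, v ord0 i \in `[- 1, 1]].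
have cK : compact K.
  apply: compact_closed_cube.
  have -> : [set z : 'rV[R]_n.+1 | height z = 1] =
     (fun z : 'rV[R]_n.+1 => z 0 ord_max) @^-1` [set (1 : R)] by [].
  apply: closed_comp; last exact: closed_eq.
  by move=> z _; exact: coord_continuous.
have KH z : K z -> H z by move=> [hz _]; rewrite /H /half_space /= -/(height z) hz.
have cuK : {within K, continuous u}.
  by apply: continuous_subspaceW u_cont => z /KH; exact: subset_closure.
have K0 : K !=set0.
  exists (\row_i 1); split; first by rewrite /= /height mxE.
  by move=> i; rewrite mxE in_itv /=; apply/andP; split; lra.
have [z /set_mem Kz hz] := EVT_min_rV K0 cK cuK.
exists (u z); first exact/u_gt0/KH.
move=> y [h1 hy]; have hy0 : 0 < height y by exact: lt_le_trans h1.
have Ky : K ((height y)^-1 *: y).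
  split; first by rewrite /= {1}/height mxE mulVf// gt_eqF.
  move=> i; rewrite mxE in_itv /= -ler_norml normrM normfV (gtr0_norm hy0).
  by rewrite mulrC ler_pdivrMr// mul1r.
apply: (le_trans (hz _ (mem_set Ky))).
have E : height y *: ((height y)^-1 *: y) = y by rewrite scalerA mulfV ?scale1r// gt_eqF.
by have := ray_monotone (KH _ Ky) h1; rewrite E.
Qed.

Let N : R := n.+1%:R.
Let N0 : 0 < N. Proof. by rewrite ltr0n. Qed.

(** For a point of the cone at height s, a box of the cone at heights between 2s and 3s: away from
    that point, but at distance comparable to s, with all sides at least s. *)
Let corner (s : R) (i : 'I_n.+1) : R * R := if i == ord_max then (2 * s, 3 * s) else (- s, s).

Let corner_le (s : R) i : 0 < s -> (corner s i).1 + s <= (corner s i).2.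
Proof. by move=> s0; rewrite /corner; case: ifP => _ /=; lra. Qed.

Let measure_corner (s : R) : 0 < s -> ((s ^+ n.+1)%:E <= mu (box (corner s)))%E.
Proof.
move=> s0; have h i := corner_le i s0.
rewrite lebesgue_rV_box => [|i]; last by have := h i; lra.
rewrite lee_fin -[X in s ^+ X](card_ord n.+1) -prodr_const.
by apply: ler_prod => i _; rewrite (ltW s0) /=; have := h i; lra.
Qed.

Let cornerP (s : R) y : 0 < s -> box (corner s) y ->
  [/\ 2 * s <= height y, height y <= 3 * s, forall i, `|y 0 i| <= height y &
      forall i, i != ord_max -> `|y 0 i| <= s].
Proof.
move=> s0 hy.
have h1 : 2 * s <= height y /\ height y <= 3 * s.
  by have /andP[] := hy ord_max; rewrite /corner eqxx.
have h2 i : i != ord_max -> `|y 0 i| <= s.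
  by move=> im; have := hy i; rewrite /corner (negbTE im) /= ler_norml.
split; [by case: h1|by case: h1| |exact: h2].
move=> i; have [->|im] := eqVneq i ord_max.
  by rewrite -/(height y) ger0_norm//; lra.
by have := h2 i im; lra.
Qed.

Let sqn_le y (r : R) : 0 <= r -> (forall i, `|y 0 i| <= r) -> sqn y <= N * r ^+ 2.
Proof.
move=> r0 h; rewrite /N mulr_natl -[X in _ *+ X](card_ord n.+1) -sumr_const.
apply: ler_sum => i _; rewrite -expr2 -real_normK ?num_real//.
by rewrite ler_sqr ?nnegrE.
Qed.

(** On the box 4 s^2 <= |y|^2 <= 9 N s^2. In [c0] the term 2/N is 4 times 1/(2N), the lower bound s
    (2s) / (N (2s)^2) of [hratio x y]. *)
Let kappa : R := Num.min (4 `^ (a / 2)) ((9 * N) `^ (a / 2)).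
Let c0 : R := C / 2 * ln (1 + 2 / N) * kappa.

Let c0_gt0 : 0 < c0.
Proof.
have ln0 : 0 < ln (1 + 2 / N) by rewrite ln_gt0// ltrDl divr_gt0.
rewrite /c0 mulr_gt0//; first by rewrite mulr_gt0// divr_gt0.
by rewrite lt_min !powR_gt0// mulr_gt0.
Qed.

Lemma cone_blow_up (t m : R) : 0 < t -> 0 <= m -> (forall y, cone t y -> m <= u y) ->
  forall x, cone t x -> c0 * t `^ (N + a) * m `^ p <= u x.
Proof.
move=> t0 m0 hm x [tx hx]; set s := height x in tx hx.
have s0 : 0 < s by exact: lt_le_trans tx.
have Hx : H x by exact: s0.
have p0 : 0 <= p by apply: le_trans p_ge1.
have mB : measurable (box (corner s)) by exact: measurable_box.
have gf0 y : 0 <= gker C x y * f y by exact: gker_source_ge0.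
have mgf : measurable_fun setT (fun y => gker C x y * f y).
  exact: (measurable_funM (measurable_gker C x) mf).
(* A lower bound of the integrand on the box. Multiplied by the volume, at least s^N, it gives c0
   s^(N + a) m^p, and s may be lowered to t since N + a > 0. *)
pose v := c0 * s `^ a * m `^ p.
have v0 : 0 <= v.
  apply: mulr_ge0; last exact: powR_ge0.
  by apply: mulr_ge0; [exact: ltW|exact: powR_ge0].
have low y : box (corner s) y -> v <= gker C x y * f y.
  move=> /(cornerP s0) [h1 h2 h3 h4].
  have hy0 : 0 < height y by apply: lt_le_trans h1; rewrite mulr_gt0.
  have Hy : H y by exact: hy0.
  have qxy0 : 0 < sqn (x - y).
    rewrite sqn_gt0 subr_eq0; apply/eqP => xy; move: h1; rewrite -xy -/s; lra.
  have qxy : sqn (x - y) <= N * (2 * s) ^+ 2.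
    apply: sqn_le => [|i]; first by rewrite mulr_ge0// ltW.
    rewrite !mxE; have [->|im] := eqVneq i ord_max.
      rewrite -/(height x) -/(height y) -/s ler_norml; apply/andP; split; lra.
    apply: (le_trans (ler_normB _ _)).
    by have := hx i; have := h4 i im; lra.
  have rat : (2 * N)^-1 <= hratio x y.
    rewrite /hratio -/s ler_pdivlMr// -div1r mulrAC mul1r ler_pdivrMr ?mulr_gt0//.
    apply: (le_trans qxy).
    have -> : N * (2 * s) ^+ 2 = s * (2 * s) * (2 * N) by ring.
    by rewrite ler_wpM2r ?mulr_ge0 ?(ltW N0)// ler_wpM2l// ltW.
  have gl : C / 2 * ln (1 + 2 / N) <= gker C x y.
    have -> : gker C x y = C / 2 * ln (1 + 4 * hratio x y) by [].
    apply: ler_wpM2l; first by rewrite divr_ge0// ltW.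
    have e2 : 2 / N = 4 * (2 * N)^-1 by field; rewrite gt_eqF.
    have r0 : 0 < 2 / N by rewrite divr_gt0.
    have h : 2 / N <= 4 * hratio x y by rewrite e2; apply: ler_wpM2l.
    by move: r0 h; move: (2 / N) (hratio x y) => A B A0 AB; rewrite ler_ln ?posrE; lra.
  have wl : kappa * s `^ a <= sqn y `^ (a / 2).
    apply: powR_ge_min => //.
      apply: le_trans (sqr_coord_le_sqn y ord_max); rewrite -/(height y).
      have -> : 4 * s ^+ 2 = (2 * s) ^+ 2 by ring.
      by rewrite ler_sqr ?nnegrE ?(ltW hy0)// mulr_ge0// ltW.
    have -> : 9 * N * s ^+ 2 = N * (3 * s) ^+ 2 by ring.
    apply: sqn_le; first by rewrite mulr_ge0// ltW.
    by move=> i; exact: le_trans (h3 i) h2.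
  have ul : m `^ p <= u y `^ p.
    have my : m <= u y by apply: hm; split => //; lra.
    by apply: ge0_ler_powR => //; rewrite nnegrE ltW// u_gt0.
  have kap0 : 0 <= kappa * s `^ a.
    by rewrite mulr_ge0 ?powR_ge0// le_min !powR_ge0.
  have ln0 : 0 <= ln (1 + 2 / N) by rewrite ln_ge0// lerDl divr_ge0// ltW.
  have -> : v = C / 2 * ln (1 + 2 / N) * (kappa * s `^ a * m `^ p) by rewrite /v /c0; ring.
  rewrite /f /source hy0; apply: ler_pM => //.
  - by apply: mulr_ge0 => //; rewrite divr_ge0// ltW.
  - by apply: mulr_ge0 => //; exact: powR_ge0.
  - by apply: ler_pM => //; exact: powR_ge0.
have main : ((v * s ^+ n.+1)%:E <= (u x)%:E)%E.
  rewrite uE//; apply: (@le_trans _ _ (\int[mu]_(y in box (corner s)) v%:E)%E).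
    rewrite integral_cst// EFinM; apply: lee_wpmul2l; first by rewrite lee_fin.
    exact: measure_corner.
  apply: (@le_trans _ _ (\int[mu]_(y in box (corner s)) (gker C x y * f y)%:E)%E).
    apply: ge0_le_integral => //.
    by apply: measurable_funTS; apply/measurable_EFinP.
  apply: ge0_subset_integral => //; first exact/measurable_EFinP.
  by move=> y _; rewrite lee_fin.
move: main; rewrite lee_fin; apply: le_trans.
have -> : v * s ^+ n.+1 = c0 * s `^ (N + a) * m `^ p.
  rewrite powRD; last by apply/implyP => _; rewrite gt_eqF.
  by rewrite powR_mulrn ?(ltW s0)// /v; ring.
apply: ler_wpM2r; first exact: powR_ge0.
apply: ler_wpM2l; first exact: ltW.
apply: ge0_ler_powR => //; [|by rewrite nnegrE ltW..].
by rewrite -lerBlDl sub0r ltW.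
Qed.

Lemma no_positive_solution : False.
Proof.
have [m0 m00 hm0] := cone_lower_bound.
have na : 0 < N + a by rewrite -ltrBlDl sub0r.
pose q := 2 / (c0 * m0 `^ (p - 1)).
have cm0 : 0 < c0 * m0 `^ (p - 1) by rewrite mulr_gt0 ?c0_gt0// powR_gt0.
(* Chosen so that c0 t^(N + a) m0^(p - 1) >= 2. The maximum with 1 places the cone above height t
   inside the one above height 1. *)
pose t := (Num.max 1 q) `^ (N + a)^-1.
have mx1 : 1 <= Num.max 1 q by rewrite le_max lexx.
have t1 : 1 <= t.
  have : (1 : R) `^ (N + a)^-1 <= t.
    by apply: ge0_ler_powR => //; rewrite ?invr_ge0 ?nnegrE ?(ltW na)//; lra.
  by rewrite powR1.
have t0 : 0 < t by exact: lt_le_trans t1.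
have tq : q <= t `^ (N + a).
  rewrite -powRrM mulVf ?gt_eqF// powRr1; last by lra.
  by rewrite le_max lexx orbT.
have c2 : 2 <= c0 * t `^ (N + a) * m0 `^ (p - 1).
  by rewrite mulrAC mulrC -ler_pdivrMr.
have iter k : forall y, cone t y -> 2 ^+ k * m0 <= u y.
  elim: k => [|k IH] y hy.
    rewrite expr0 mul1r; apply: hm0; case: hy => h1 h2; split => //.
    exact: le_trans h1.
  have mk0 : 0 < 2 ^+ k * m0 by rewrite mulr_gt0// exprn_gt0.
  (* The cone stays the same at every round. As p >= 1, the factor (2^k m0)^(p - 1) is at least
     m0^(p - 1), so the bound at least doubles each time. *)
  apply: le_trans (cone_blow_up t0 (ltW mk0) IH hy).
  have -> : (2 ^+ k * m0) `^ p = (2 ^+ k * m0) `^ (p - 1) * (2 ^+ k * m0).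
    rewrite -{3}(powRr1 (ltW mk0)) -powRD ?subrK//.
    by apply/implyP => _; rewrite gt_eqF.
  rewrite exprS -[leLHS]mulrA [leRHS]mulrA; apply: ler_wpM2r; first exact: ltW.
  apply: (le_trans c2); apply: ler_wpM2l.
    by apply: mulr_ge0; [exact: (ltW c0_gt0)|exact: powR_ge0].
  apply: ge0_ler_powR; rewrite ?subr_ge0 ?nnegrE ?(ltW mk0) ?(ltW m00)//.
  by rewrite ler_peMl ?(ltW m00)// exprn_ege1// ler1n.
pose e : 'rV[R]_n.+1 := \row_i t.
have he : cone t e.
  by split => [|i]; rewrite /height !mxE// ger0_norm// ltW.
have [k hk] := pow2_ge_nat (u e / m0 + 1).
have := iter k e he; rewrite -ler_pdivlMr//; lra.
Qed.

End blow_up.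

Theorem theorem1p4 (R : realType) (n : nat) (C p a : R)
    (u : 'rV[R]_n.+1 -> R)
    (C_norm : normalization_constant n C)
    (p_ge1 : 1 <= p)
    (a_gt : - n.+1%:R < a)
    (u_cont : {within closure (@half_space R n), continuous u})
    (u_ge0 : forall x, closure (@half_space R n) x -> 0 <= u x)
    (u_sol : integral_solution C p a u) :
  forall x, closure (@half_space R n) x -> u x = 0.
Proof.
have [C0 _] := C_norm.
(* The equation is available in the open half space only; the boundary values follow by
   continuity. *)
apply: (eq0_closure u_cont) => x hx; apply/eqP; apply: contraT => ux0; exfalso.
have u0 y : half_space y -> 0 <= u y by move=> hy; apply: u_ge0; exact: subset_closure.
have mf := measurable_source C0 u_sol.
have uE := integral_gker_source C0 u_sol.
have cu := cont_half_space u_cont.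
have ux : 0 < u x by rewrite lt_def ux0 u0.
have upos := positive_half_space C0 p_ge1 u0 mf uE hx ux cu.
have mono := sphere_monotoneT C0 p_ge1 a_gt u0 mf uE cu (bounded_half_space u_cont) upos.
exact: (no_positive_solution C0 p_ge1 a_gt upos mf uE u_cont mono).
Qed.
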